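(* Every $\alpha$-galaxy satisfies the Erdős–Hajnal Conjecture: for every $\alpha$-galaxy $H$ there exists $\epsilon(H)>0$ such that every tournament $T$ not containing $H$ as a subtournament contains a transitive subtournament on at least $|T|^{\epsilon(H)}$ vertices.
   Context: Tournaments are finite; subtournament = induced subtournament; transitive = no directed cycle. Given an ordering of the vertex set, an edge $(x,y)$ is backward if $y$ precedes $x$; a tournament on an ordered vertex set is determined by its backward edges. For an ordering $\theta=(v_1,\dots,v_n)$ of $V(T)$, $B(T,\theta)$ is the undirected graph on $V(T)$ whose edges are the pairs joined by backward edges. A right (resp. left) star is an induced subgraph of $B(T,\theta)$ that is a star $K_{1,t}$ whose center is the last (resp. first) of its vertices in $\theta$ (for $t=1$ either vertex may be the center). $T$ is a galaxy if for some ordering $\theta$ (a galaxy ordering) every component of $B(T,\theta)$ is a left star, a right star or a singleton, and no center of a star lies between two leaves of another star; non-singleton components are the stars. Product: for tournaments $H_1,H_2$ with disjoint vertex sets and injective $f_1,f_2$ into $\mathbb{N}$ with disjoint images, with $\theta_i$ ordering $V(H_i)$ by increasing $f_i$ and $\theta$ ordering $V(H_1)\cup V(H_2)$ by the combined values, $H_1^{f_1}\oplus H_2^{f_2}$ is the tournament on $V(H_1)\cup V(H_2)$ whose backward edges under $\theta$ are exactly those of $H_1$ under $\theta_1$ and of $H_2$ under $\theta_2$. $\alpha$-galaxy: let $H_s$ have vertices $h_1,\dots,h_7$ with backward edges under $(h_1,\dots,h_7)$ exactly $(h_4,h_1),(h_6,h_4),(h_6,h_3),(h_7,h_5)$. Let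 $G$ be a galaxy with galaxy ordering $(g_1,\dots,g_r)$, let $0\le r_1\le r$ be such that no star of $G$ has one leaf in $\{g_1,\dots,g_{r_1}\}$ and another leaf in $\{g_{r_1+1},\dots,g_r\}$, and let $r_2,r_3\ge0$ with $r=r_1+r_2+r_3$. Set $\rho_2(g_i)=5+i$ for $i\le r_1$, $\rho_2(g_i)=6+i$ for $r_1<i\le r_1+r_2$, $\rho_2(g_i)=7+i$ for $r_1+r_2<i\le r$; $\rho_1(h_i)=i$ for $i\le5$, $\rho_1(h_6)=6+r_1$, $\rho_1(h_7)=7+r_1+r_2$. Then $H_s^{\rho_1}\oplus G^{\rho_2}$ is an $\alpha$-galaxy. *)

(* Defs.v *)
From mathcomp Require Import all_boot all_order all_algebra.
From mathcomp Require Import zify.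
From mathcomp Require Import reals exp.

Set Implicit Arguments.
Unset Strict Implicit.
Unset Printing Implicit Defensive.

Record tournament := Tournament {
  tvertex :> finType;
  tarc : rel tvertex;
  tarc_irr : irreflexive tarc;
  tarc_total : forall x y : tvertex, x != y -> tarc x y (+) tarc y x }.

Definition contains (T H : tournament) : Prop :=
  exists f : H -> T, injective f /\ {mono f : x y / tarc x y}.

Definition tournament_iso (T H : tournament) : Prop :=
  exists f : T -> H, bijective f /\ {mono f : x y / tarc x y}.

Definition transitive_on (T : tournament) (S : {set T}) : Prop :=
  forall c : seq T, c != [::] -> {subset c <= S} -> ~ ucycle (@tarc T) c.

Definition erdos_hajnal (R : realType) (H : tournament) : Prop :=
  exists eps : R, (0 < eps)%R /\
    forall T : tournament, ~ contains T H ->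
      exists S : {set T}, transitive_on S /\ (#|T|%:R `^ eps <= #|S|%:R)%R.

Section Galaxy.
Variables (T : tournament) (s : seq T).

Definition ordering : bool := perm_eq s (enum T).

Definition before (x y : T) : bool := index x s < index y s.

Definition backward (x y : T) : bool := tarc x y && before y x.

(* The undirected graph B(T, s). *)
Definition bgraph (x y : T) : bool := backward x y || backward y x.

Definition component (C : {set T}) : Prop :=
  exists x, C = [set y | connect bgraph x y].

(* The subgraph of B(T, s) induced on C is K_{1,t} for some t >= 1, with
   center c; when t = 1 either vertex of C may play the role of c. *)
Definition star_at (C : {set T}) (c : T) : Prop :=
  [/\ c \in C, 1 < #|C| &
      {in C &, forall x y, bgraph x y = (x == c) (+) (y == c)}].

Definition right_star (C : {set T}) (c : T) : Prop :=
  star_at C c /\ {in C :\ c, forall x, before x c}.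

Definition left_star (C : {set T}) (c : T) : Prop :=
  star_at C c /\ {in C :\ c, forall x, before c x}.

Definition star (C : {set T}) : Prop := component C /\ 1 < #|C|.

(* The set Z records the chosen centers: it meets each star exactly in its
   center, so that the leaves of a star C are C :\: Z.  The choice matters only
   for one-edge stars. *)
Definition galaxy_centers (Z : {set T}) : Prop :=
  (forall C, component C ->
     #|C| = 1 \/
     exists c, C :&: Z = [set c] /\ (left_star C c \/ right_star C c)) /\
  (forall C D, star C -> star D -> C != D ->
     forall c x y, c \in C :&: Z -> x \in D :\: Z -> y \in D :\: Z ->
       ~~ (before x c && before c y)).

Definition galaxy_ordering (Z : {set T}) : Prop :=
  ordering /\ galaxy_centers Z.

End Galaxy.

Section FromBackward.
Variables (V : finType) (f : V -> nat) (b : rel V).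

Definition arc_of_backward (x y : V) : bool :=
  (x != y) && (if f x < f y then ~~ b y x else b x y).

Lemma arc_of_backward_irr : irreflexive arc_of_backward.
Proof. by move=> x; rewrite /arc_of_backward eqxx. Qed.

Lemma arc_of_backward_total : injective f -> forall x y : V, x != y ->
  arc_of_backward x y (+) arc_of_backward y x.
Proof.
move=> f_inj x y neq_xy; rewrite /arc_of_backward neq_xy eq_sym neq_xy /=.
have: f x != f y by apply: contra neq_xy => /eqP/f_inj->.
by case: ltngtP => //= _ _; case: (b _ _).
Qed.

End FromBackward.

(* Vertices are ordered by increasing f; a pair (x, y) with f y < f x is an
   arc iff b x y, and values of b on other pairs are ignored. *)
Definition tournament_of_backward (V : finType) (f : V -> nat)
    (f_inj : injective f) (b : rel V) : tournament :=
  Tournament (@arc_of_backward_irr V f b) (arc_of_backward_total b f_inj).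

Section Product.
Variables (H1 H2 : tournament) (f1 : H1 -> nat) (f2 : H2 -> nat).

Definition sum_label (u : H1 + H2) : nat :=
  match u with inl x => f1 x | inr y => f2 y end.

Definition sum_backward (u v : H1 + H2) : bool :=
  match u, v with
  | inl x, inl y => tarc x y && (f1 y < f1 x)
  | inr x, inr y => tarc x y && (f2 y < f2 x)
  | _, _ => false
  end.

(* Injectivity of the combined labelling says that f1 and f2 are injective
   with disjoint images. *)
Definition product (f_inj : injective sum_label) : tournament :=
  tournament_of_backward f_inj sum_backward.

End Product.

(* h_k is the ordinal k - 1. *)
Definition Hs_backward (x y : 'I_7) : bool :=
  (x.+1, y.+1) \in [:: (4, 1); (6, 4); (6, 3); (7, 5)].

Definition Hs : tournament := tournament_of_backward (@ord_inj 7) Hs_backward.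

Definition rho1 (r1 r2 : nat) (h : Hs) : nat :=
  let i := (h : 'I_7).+1 in
  if i <= 5 then i else if i == 6 then 6 + r1 else 7 + r1 + r2.

Definition rho2 (G : tournament) (s : seq G) (r1 r2 : nat) (g : G) : nat :=
  let i := (index g s).+1 in
  if i <= r1 then 5 + i else if i <= r1 + r2 then 6 + i else 7 + i.

Lemma rho_inj (G : tournament) (s : seq G) (r1 r2 : nat) :
  ordering s -> injective (sum_label (rho1 r1 r2) (rho2 s r1 r2)).
Proof.
move=> /perm_mem s_all.
have s_inj (x y : G) : index x s = index y s -> x = y.
  by move=> /(congr1 (nth x s)); rewrite !nth_index ?s_all ?mem_enum.
case=> [[x ltx]|x] [[y lty]|y]; rewrite /= /rho1 /rho2 /= => eq_xy.
- by congr inl; apply: val_inj => /=; move: eq_xy; do !case: ifP; lia.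
- by exfalso; move: eq_xy; do !case: ifP; lia.
- by exfalso; move: eq_xy; do !case: ifP; lia.
- by congr inr; apply: s_inj; move: eq_xy; do !case: ifP; lia.
Qed.

Definition no_split_star (T : tournament) (s : seq T) (Z : {set T}) (k : nat)
    : Prop :=
  forall C, star s C -> forall x y, x \in C :\: Z -> y \in C :\: Z ->
    ~~ ((index x s < k) && (k <= index y s)).

Definition alpha_galaxy (H : tournament) : Prop :=
  exists (G : tournament) (s : seq G) (Z : {set G}) (s_gal : galaxy_ordering s Z)
         (r1 r2 r3 : nat),
    [/\ #|G| = r1 + r2 + r3, no_split_star s Z r1 &
        tournament_iso H
          (product (rho_inj (r1 := r1) (r2 := r2) (proj1 s_gal)))].

(* Main.v *)
Require Import Defs.
From mathcomp Require Import all_boot all_order all_algebra.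
From mathcomp Require Import zify ring lra.
From mathcomp Require Import reals exp.

(* Write tr Y for the largest size of a transitive subset of Y.  The vertices
   h1, h2, h3, h4, h6 span the tournament [five]; ordered as h2, h4, h1, h3, h6,
   the other vertices are joined to them by forward arcs only, apart from the
   separation made by h6, and form a galaxy together with h5, h7.

   By induction on Y one finds B <= tr Y and a random transitive S in Y with
   B E|S| >= |Y|^eta / tr Y that each z outside Y spanning no copy of [five] with
   Y (a good z) attacks with probability at most tr (N_Y z) / B; for Y = V(T)
   this gives (tr Y)^3 >= |Y|^eta.  If tr drops by a constant factor on some
   linear subset Z of Y, pass to Z.  Otherwise Y contains a long sequence X_0,
   X_1, ... of linear sets with few backward arcs, and every linear subset of Y
   has almost the same tr as Y.  This tightness has two effects.
   - For good z, the out-neighbourhoods of z in distinct X_i are joined by forward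
     arcs only, whence sum_i tr (N_{X_i} z) <= tr (N_Y z).
   - The stars of the galaxy can be embedded in the X_i around a vertex z of X_k,
     so in an H-free tournament z is good for the union of the X_i far to its left.
   Two blocks of sets X_i are used.  If sum_i B_i is small over a block, a random
   X_i of that block will do; if it is large over both, sets S' and S are drawn
   from the right and the left block, and S together with the vertices of S' that
   attack no vertex of S will do. *)

Set Implicit Arguments.
Unset Strict Implicit.
Unset Printing Implicit Defensive.

(** A large expected size alone would not survive the merging of two blocks: few vertices of [S']
    may attack [S], so attack probabilities belong to the invariant. The factor [B] links both
    requirements. A vertex [z] attacking most of some [X_i] has no chain of out-neighbourhoods, but
    by tightness [tr (N_Y z)] is at least [2/3 tr Y]; so once [B <= 2/3 tr Y] its attack bound
    exceeds 1 and is void. This is why no new [B] exceeds [2/3 tr Y].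

    Constants: a block has 40 sets, and [B_i <= tr Y] puts [sum_i B_i] below [40 tr Y]. If the sum
    is at most [10 tr Y], lowering it to [2/3 tr Y] keeps at least [1/15] of the 40 contributions.
    If it is at least [10 tr Y], attack probabilities are at most [1/10]; merging then costs about a
    tenth of [S'], and two sets compensate the factor [2/3], as [2/3 * 19/10 > 16/15]. Here [16/15]
    is the loss allowed for replacing [Y] by an [X_i], and [eta] is chosen small enough for that. *)

Section Counting.

Lemma leq_card_bigcup (I T : finType) (P : pred I) (A : I -> {set T}) :
  #|\bigcup_(i | P i) A i| <= \sum_(i | P i) #|A i|.
Proof.
apply: (big_ind2 (fun (X : {set T}) n => #|X| <= n)) => [|X m Y n leX leY|//].
  by rewrite cards0.
by rewrite (leq_trans _ (leq_add leX leY)) // cardsU leq_subr.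
Qed.

Lemma pigeonhole (I T : finType) (D : {set I}) (A : {set T}) (P : I -> pred T) :
  (forall x, x \in A -> exists2 i, i \in D & P i x) -> 0 < #|A| ->
  exists2 i, i \in D & #|A| <= #|D| * #|[set x in A | P i x]|.
Proof.
move=> PA A_gt0.
case: (boolP [exists i in D, #|A| <= #|D| * #|[set x in A | P i x]|]).
  by case/exists_inP=> i Di le_A; exists i.
rewrite negb_exists_in => /forall_inP noP.
have /subset_leq_card leA : A \subset \bigcup_(i in D) [set x in A | P i x].
  apply/subsetP=> x Ax; have [i Di Pix] := PA x Ax.
  by apply/bigcupP; exists i => //; rewrite inE Ax.
have [x0 Ax0] := card_gt0P A_gt0; have [i0 Di0 _] := PA x0 Ax0.
have D_gt0 : 0 < #|D| by apply/card_gt0P; exists i0.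
have {leA} : #|A| <= \sum_(i in D) #|[set x in A | P i x]|.
  apply: leq_trans leA _.
  exact: leq_card_bigcup.
have lt_s : \sum_(i in D) (#|D| * #|[set x in A | P i x]|) < \sum_(i in D) #|A|.
  rewrite [X in X < _](bigD1 i0) //= [X in _ < X](bigD1 i0) //= -addSn.
  apply: leq_add; first by rewrite ltnNge noP.
  by apply: leq_sum => i /andP[Di _]; rewrite ltnW // ltnNge noP.
move: lt_s; rewrite -big_distrr sum_nat_const ltn_pmul2l //= => lt_s le_s.
by have := leq_ltn_trans le_s lt_s; rewrite ltnn.
Qed.

Lemma sum_card_exchange (T : finType) (A B : {set T}) (P : rel T) :
  \sum_(a in A) #|[set b in B | P a b]| = \sum_(b in B) #|[set a in A | P a b]|.
Proof.
under eq_bigr do rewrite -sum1_card.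
under [RHS]eq_bigr do rewrite -sum1_card.
rewrite (exchange_big_dep (fun b => b \in B)) /=; last first.
  by move=> a b _; rewrite inE => /andP[].
apply: eq_bigr => b Bb; apply: eq_bigl => a.
by rewrite !inE Bb.
Qed.

Lemma markov_card (T : finType) (A : {set T}) (F : T -> nat) (m : nat) :
  #|[set x in A | m <= F x]| * m <= \sum_(x in A) F x.
Proof.
rewrite -sum_nat_const big_mkcond [X in _ <= X]big_mkcond /=.
by apply: leq_sum => x _; rewrite inE; case: (x \in A) => //=; case: ifP.
Qed.

Lemma leq_cardD (T : finType) (A B C : {set T}) :
  A \subset B :|: C -> #|A| <= #|B| + #|C|.
Proof.
by move=> /subset_leq_card/leq_trans; apply; rewrite cardsU leq_subr.
Qed.

Lemma exists_subset (T : finType) (A : {set T}) m :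
  m <= #|A| -> exists2 B : {set T}, B \subset A & #|B| = m.
Proof.
elim: m => [|m IHm] le_mA; first by exists set0; rewrite ?sub0set ?cards0.
have [B sBA cB] := IHm (ltnW le_mA).
have /card_gt0P[x] : 0 < #|A :\: B|.
  by rewrite cardsD (setIidPr sBA) cB subn_gt0.
rewrite inE => /andP[nBx Ax]; exists (x |: B).
  by rewrite subUset sub1set Ax.
by rewrite cardsU1 nBx cB.
Qed.

Lemma exists_parts (I T : finType) (s : seq I) (A : {set T}) m :
  uniq s -> size s * m <= #|A| -> exists C : I -> {set T},
  {in s, forall i, C i \subset A /\ #|C i| = m} /\
  {in s &, forall i j, i != j -> [disjoint C i & C j]}.
Proof.
elim: s A => [|i s IHs] A; first by exists (fun _ => set0); split.
rewrite /= mulSn => /andP[nsi us] le_A.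
have [B sBA cB] := exists_subset (leq_trans (leq_addr _ _) le_A).
have le_AB : size s * m <= #|A :\: B|.
  by rewrite cardsD (setIidPr sBA) cB leq_subRL // (leq_trans (leq_addr _ _) le_A).
have [C [C1 C2]] := IHs _ us le_AB.
have CB j : j \in s -> [disjoint C j & B].
  move=> sj; have [/subsetDP[_ dj] _] := C1 j sj; exact: dj.
exists (fun j => if j == i then B else C j); split=> [j|j k]; rewrite !inE.
  case: eqP => //= _ sj; have [/subsetDP[sC _] ->] := C1 j sj; by split.
case: (eqVneq j i) => [->|ji] /=; case: (eqVneq k i) => [->|ki] //= sj sk jk.
- by rewrite disjoint_sym CB.
- by rewrite CB.
- exact: C2.
Qed.

End Counting.

(** * Transitive subsets and their maximal size [tr] *)

Section Tournament.
Variable T : tournament.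
Implicit Types (A B S Y Z : {set T}) (x y z w : T).

Lemma arc_neg x y : x != y -> ~~ tarc x y -> tarc y x.
Proof. by move=> /tarc_total; case: (tarc x y). Qed.

Lemma arc_asym x y : tarc x y -> ~~ tarc y x.
Proof.
case: (eqVneq x y) => [->|/tarc_total]; first by rewrite tarc_irr.
by case: (tarc x y); case: (tarc y x).
Qed.

Lemma arc_neq x y : tarc x y -> x != y.
Proof. by apply: contraTneq => ->; rewrite tarc_irr. Qed.

Definition outN Y z := [set w in Y | tarc z w].
Definition inN Y z := [set w in Y | tarc w z].

Definition fwd A B := [forall x in A, forall y in B, tarc x y].

Lemma fwdP A B : reflect {in A & B, forall x y, tarc x y} (fwd A B).
Proof.
apply: (iffP forall_inP) => [AB x y Ax By|AB x Ax].
  by move/forall_inP: (AB x Ax) => /(_ y By).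
by apply/forall_inP=> y By; apply: AB.
Qed.

Lemma fwdS A B A' B' : A' \subset A -> B' \subset B -> fwd A B -> fwd A' B'.
Proof.
by move=> /subsetP sA /subsetP sB /fwdP AB; apply/fwdP=> x y /sA Ax /sB; apply: AB.
Qed.

(** This local condition excludes directed cycles of every length, and it is boolean, as the maximum
    in [tr] requires. *)
Definition trans_set S :=
  [forall x in S, forall y in S, forall z in S,
     tarc x y ==> tarc y z ==> tarc x z].

Lemma trans_setP S :
  reflect {in S & S & S, forall x y z, tarc x y -> tarc y z -> tarc x z}
          (trans_set S).
Proof.
apply: (iffP forall_inP) => [trS x y z Sx Sy Sz xy yz|trS x Sx].
  move: (trS x Sx) => /forall_inP/(_ y Sy)/forall_inP/(_ z Sz).
  by rewrite xy yz.
apply/forall_inP=> y Sy; apply/forall_inP=> z Sz.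
by apply/implyP=> xy; apply/implyP; apply: trS.
Qed.

Lemma trans_set_transitive S : trans_set S -> transitive_on S.
Proof.
move=> /trans_setP trS [//|x c] _ sub /andP[cyc _].
suff: tarc x x by rewrite tarc_irr.
have tr_in : {in [in S] & &, transitive (@tarc T)}.
  by move=> y x' z Sy Sx Sz; apply: trS.
have allS : all [in S] (x :: rcons c x).
  apply/allP=> y; rewrite inE mem_rcons inE => /or3P[/eqP->|/eqP->|cy];
  by apply: sub; rewrite inE ?eqxx ?cy ?orbT.
move: cyc; rewrite /= (path_sorted_inE tr_in) => [/andP[/allP cx _]|].
  by apply: cx; rewrite mem_rcons inE eqxx.
exact: allS.
Qed.

Lemma trans_setS S S' : S' \subset S -> trans_set S -> trans_set S'.
Proof.
move=> /subsetP sS /trans_setP trS; apply/trans_setP=> x y z Sx Sy Sz.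
by apply: trS; apply: sS.
Qed.

Lemma trans_setU A B : fwd A B -> trans_set A -> trans_set B ->
  trans_set (A :|: B).
Proof.
move=> /fwdP AB /trans_setP trA /trans_setP trB.
apply/trans_setP=> x y z; rewrite !inE.
have nBA u v : u \in A -> v \in B -> tarc v u = false.
  by move=> Au Bv; apply/negbTE/arc_asym/AB.
case/orP=> Hx /orP[] Hy /orP[] Hz; rewrite ?(nBA _ _ Hy Hx) ?(nBA _ _ Hz Hy) //.
- exact: trA.
- by move=> _ _; apply: AB.
- by move=> _ _; apply: AB.
- exact: trB.
Qed.

Lemma trans_set1 x : trans_set [set x].
Proof. by apply/trans_setP=> u v w /set1P-> /set1P-> /set1P->. Qed.

Lemma trans_set0 : trans_set set0.
Proof. by apply/trans_setP=> u v w; rewrite inE. Qed.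

Lemma fwd_disjoint A B : fwd A B -> [disjoint A & B].
Proof.
move=> /fwdP AB; rewrite disjoint_subset; apply/subsetP=> x Ax; rewrite inE.
by apply/negP=> Bx; have := AB x x Ax Bx; rewrite tarc_irr.
Qed.

Lemma card_fwdU A B : fwd A B -> #|A :|: B| = #|A| + #|B|.
Proof. by move=> /fwd_disjoint; rewrite cardsU -setI_eq0 => /eqP->; rewrite cards0 subn0. Qed.

Definition tr Y := \max_(S : {set T} | (S \subset Y) && trans_set S) #|S|.

Lemma leq_tr S Y : S \subset Y -> trans_set S -> #|S| <= tr Y.
Proof. by move=> sSY trS; apply: leq_bigmax_cond; rewrite sSY. Qed.

Lemma tr_witness Y : exists S, [/\ S \subset Y, trans_set S & #|S| = tr Y].
Proof.
have [|S /andP[sSY trS] maxS] :=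
  @eq_bigmax_cond _ [pred S : {set T} | (S \subset Y) && trans_set S] (fun S => #|S|).
  by apply/card_gt0P; exists set0; rewrite inE sub0set trans_set0.
by exists S; split=> //; rewrite -maxS; apply: eq_bigl.
Qed.

Lemma tr_le_card Y : tr Y <= #|Y|.
Proof. by have [S [/subset_leq_card sSY _ <-]] := tr_witness Y. Qed.

Lemma trS Y Z : Y \subset Z -> tr Y <= tr Z.
Proof.
move=> sYZ; have [S [sSY trS <-]] := tr_witness Y.
by apply: leq_tr; rewrite // (subset_trans sSY).
Qed.

Lemma tr_fwd A B Y : fwd A B -> A \subset Y -> B \subset Y -> tr A + tr B <= tr Y.
Proof.
move=> AB sAY sBY.
have [S [sSA trS <-]] := tr_witness A; have [S' [sSB trS' <-]] := tr_witness B.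
have fSS : fwd S S' by apply: fwdS AB.
rewrite -(card_fwdU fSS) leq_tr ?trans_setU //.
by rewrite subUset (subset_trans sSA) ?(subset_trans sSB).
Qed.

Lemma tr_trans S : trans_set S -> tr S = #|S|.
Proof. by move=> trS; apply/eqP; rewrite eqn_leq tr_le_card leq_tr. Qed.

Lemma tr_gt0 Y : (0 < tr Y) = (0 < #|Y|).
Proof.
apply/idP/idP => [/leq_trans->//|]; first exact: tr_le_card.
by case/card_gt0P=> x Yx; rewrite -(cards1 x) leq_tr ?sub1set ?trans_set1.
Qed.

(* Repeatedly passing to the larger of the in- and out-neighbourhoods. *)
Lemma tr_log k Y : 2 ^ k <= #|Y| -> k < tr Y.
Proof.
elim: k Y => [|k IHk] Y leY; first by rewrite tr_gt0.
have /card_gt0P[x Yx] : 0 < #|Y| by apply: leq_trans leY; rewrite expn_gt0.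
have : #|Y| <= (#|inN Y x| + #|[set x]|) + #|outN Y x|.
  rewrite -addnA addnC -addnA; apply: (leq_trans (n := #|[set x] :|: (outN Y x :|: inN Y x)|)).
    apply/subset_leq_card/subsetP=> y Yy; rewrite !inE Yy /=.
    by case: eqVneq => //= /tarc_total; case: (tarc y x); case: (tarc x y).
  by rewrite (leq_trans (leq_cardD (subxx _))) // leq_add2l leq_cardD.
rewrite cards1 => leN.
have [le1|le2] : 2 ^ k <= #|inN Y x| \/ 2 ^ k <= #|outN Y x|.
  by move: leY; rewrite expnS; lia.
- have f1 : fwd (inN Y x) [set x] by apply/fwdP=> u v; rewrite !inE => /andP[_ ux] /eqP->.
  have := tr_fwd f1 (_ : _ \subset Y) (_ : _ \subset Y).
  rewrite (tr_trans (trans_set1 x)) cards1 sub1set => /(_ _ Yx).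
  have sN : inN Y x \subset Y by apply/subsetP=> u; rewrite inE => /andP[].
  by move=> /(_ sN); have := IHk _ le1; lia.
- have f1 : fwd [set x] (outN Y x) by apply/fwdP=> u v; rewrite !inE => /eqP-> /andP[].
  have := tr_fwd f1 (_ : _ \subset Y) (_ : _ \subset Y).
  rewrite (tr_trans (trans_set1 x)) cards1 sub1set => /(_ Yx).
  have sN : outN Y x \subset Y by apply/subsetP=> u; rewrite inE => /andP[].
  by move=> /(_ sN); have := IHk _ le2; lia.
Qed.

Lemma tr_chain n (S : nat -> {set T}) Y :
  (forall i, i < n -> trans_set (S i) /\ S i \subset Y) ->
  (forall i j, i < j < n -> fwd (S i) (S j)) ->
  \sum_(i < n) #|S i| <= tr Y.
Proof.
move=> trS fS.
suff /(_ n (leqnn n))[A [sA trA <- _]] : forall m, m <= n -> exists A,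
    [/\ A \subset Y, trans_set A, #|A| = \sum_(i < m) #|S i| &
        forall j, m <= j < n -> fwd A (S j)].
  exact: leq_tr.
elim=> [_|m IHm lemn].
  exists set0; rewrite sub0set trans_set0 cards0 big_ord0; split=> // j _.
  by apply/fwdP=> x y; rewrite inE.
have [A [sA trA cA fA]] := IHm (ltnW lemn).
have [trSm sSm] := trS m lemn.
have fAm : fwd A (S m) by apply: fA; rewrite leqnn.
exists (A :|: S m); split.
- by rewrite subUset sA.
- exact: trans_setU.
- by rewrite card_fwdU // big_ord_recr /= cA.
- move=> j /andP[mj jn]; apply/fwdP=> x y; rewrite inE => /orP[Ax|Sx] Sy.
    have /fwdP-> // : fwd A (S j) by apply: fA; rewrite (ltnW mj).
  by have /fwdP-> // : fwd (S m) (S j) by apply: fS; rewrite mj.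
Qed.

(** By transitivity, an in-neighbour of [x] inside [S] has strictly more out-neighbours in [S] than
    [x]; so a vertex with the most is a source. *)
Lemma trans_set_source S : trans_set S -> 0 < #|S| ->
  exists2 x, x \in S & fwd [set x] (S :\ x).
Proof.
move=> /trans_setP trS /card_gt0P[x0 Sx0].
have [x Sx max_x] := @arg_maxnP _ x0 [in S] (fun x => #|outN S x|) Sx0.
exists x => //; apply/fwdP=> _ y /set1P-> /setD1P[yx Sy].
apply: contraT => nxy; have yx' : tarc y x by rewrite arc_neg // eq_sym.
have: #|outN S y| <= #|outN S x| by apply: max_x.
rewrite leqNgt => /negP[]; apply/proper_card/properP; split.
  apply/subsetP=> z; rewrite !inE => /andP[Sz xz]; rewrite Sz /=.
  exact: trS xz.
by exists x; rewrite !inE Sx //= tarc_irr.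
Qed.

Lemma trans_set_prefix S (w : nat) : trans_set S -> w <= #|S| ->
  exists A, [/\ A \subset S, #|A| = w & fwd A (S :\: A)].
Proof.
elim: w S => [|w IHw] S trS leS.
  exists set0; rewrite sub0set cards0; split=> //.
  by apply/fwdP=> x y; rewrite inE.
have [x Sx /fwdP fx] := trans_set_source trS (leq_trans (ltn0Sn _) leS).
have [|A [sA cA /fwdP fA]] := IHw (S :\ x) (trans_setS (subsetDl _ _) trS).
  by move: leS; rewrite (cardsD1 x S) Sx.
have nAx : x \notin A.
  by apply/negP=> /(subsetP sA); rewrite !inE eqxx.
exists (x |: A); split.
- by rewrite subUset sub1set Sx (subset_trans sA) ?subsetDl.
- by rewrite cardsU1 nAx cA.
apply/fwdP=> u v; rewrite !inE negb_or -andbA => /orP[/eqP->|Au] /and3P[vx nAv Sv].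
  by apply: fx; rewrite !inE ?vx ?eqxx.
by apply: fA; rewrite // !inE nAv vx.
Qed.

(** Used to give each rank its own segment, so that leaves sharing a slot can be placed in their
    prescribed order. *)
Lemma trans_set_segments n S (w : nat) : trans_set S -> n * w <= #|S| ->
  exists C : nat -> {set T},
  (forall i, i < n -> C i \subset S /\ #|C i| = w) /\
  (forall i j, i < j < n -> fwd (C i) (C j)).
Proof.
elim: n S => [|n IHn] S trS; first by exists (fun _ => set0); split=> // i j; rewrite ltn0 andbF.
rewrite mulSn => leS.
have [A [sA cA fA]] := trans_set_prefix trS (leq_trans (leq_addr _ _) leS).
have [|C [C1 C2]] := IHn (S :\: A) (trans_setS (subsetDl _ _) trS).
  by rewrite cardsD (setIidPr sA) cA leq_subRL // (leq_trans (leq_addr _ _) leS).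
exists (fun i => if i is i'.+1 then C i' else A); split=> [[|i]|[|i] [|j]] //= lein.
  have [sC ->] := C1 i lein; split=> //; exact: subset_trans sC (subsetDl _ _).
  have [sC _] := C1 j lein; exact: fwdS (subxx _) sC fA.
exact: C2.
Qed.

End Tournament.

(** * Sparse pairs and smooth sequences of linear sets in an [H]-free tournament *)

Section Smooth.

Lemma arcC (T : tournament) (x y : T) : x != y -> tarc y x = ~~ tarc x y.
Proof. by move=> /tarc_total; case: (tarc x y); case: (tarc y x). Qed.

(** These are the arcs from [B] to [A], backward when [A] is placed before [B]. *)
Definition back_arcs (T : tournament) (A B : {set T}) : nat :=
  \sum_(b in B) #|outN A b|.

Lemma back_arcsE (T : tournament) (A B : {set T}) :
  back_arcs A B = \sum_(a in A) #|inN B a|.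
Proof. by rewrite /back_arcs /outN sum_card_exchange. Qed.

Lemma back_arcsS (T : tournament) (A B A' B' : {set T}) :
  A' \subset A -> B' \subset B -> back_arcs A' B' <= back_arcs A B.
Proof.
move=> sA sB; rewrite /back_arcs [X in _ <= X](big_setID B') /= (setIidPr sB).
apply: leq_trans (leq_addr _ _); apply: leq_sum => b _.
by apply/subset_leq_card/subsetP=> a; rewrite !inE => /andP[/(subsetP sA)-> ->].
Qed.

(* Vertices of H are embedded one by one, each candidate set shrinking by a
   factor M at most; when no vertex of C v works, a sparse pair appears. *)
Lemma greedy_embedding (T H : tournament) (M m : nat) (x0 : T) (s : seq H) k
    (C : H -> {set T}) :
  0 < M -> 0 < m -> 0 < k -> uniq s ->
  (forall v, v \in s -> m <= k * #|C v|) ->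
  (exists f : H -> T, {in s, forall v, f v \in C v} /\
     {in s &, forall u v, u != v -> tarc (f u) (f v) = tarc u v}) \/
  (exists u v (A B : {set T}),
    [/\ [/\ u \in s, v \in s & u != v], A \subset C u, B \subset C v,
        m <= k * M ^ size s * #|H| * #|A| /\ m <= k * M ^ size s * #|H| * #|B|
        & M * back_arcs A B <= #|A| * #|B|]).
Proof.
move=> M0 m0; elim: s k C => [|v s IHs] k C k0 us mC.
  by left; exists (fun _ => x0); split.
have H0 : 0 < #|H| by apply/card_gt0P; exists v.
have M0' n : 0 < M ^ n by rewrite expn_gt0 M0.
move: us => /= /andP[nvs us].
pose dirN u x := if tarc v u then outN (C u) x else inN (C u) x.
have dirS u x : dirN u x \subset C u.
  by rewrite /dirN; case: ifP => _; apply/subsetP=> w; rewrite inE => /andP[].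
case: (boolP [exists x in C v, all (fun u => #|C u| <= M * #|dirN u x|) s]).
  case/exists_inP=> x Cx /allP good.
  have kM0 : 0 < k * M by rewrite muln_gt0 k0.
  have [|[f [f1 f2]]|[u [w [A [B [[su sw uw] sA sB [mA mB] dAB]]]]]] :=
    IHs (k * M) (fun u => dirN u x) kM0 us.
  - move=> u su; apply: leq_trans (mC u _) _; first by rewrite inE su orbT.
    by rewrite -mulnA leq_mul2l good ?orbT.
  - left; exists (fun u => if u == v then x else f u).
    have fC u : u \in s -> u != v ->
        tarc x (f u) = tarc v u /\ tarc (f u) x = tarc u v.
      move=> su uv; move: (f1 u su); rewrite /dirN.
      case: ifP => vu; rewrite inE => /andP[_ xu].
        by rewrite xu (negbTE (arc_asym xu)) (negbTE (arc_asym vu)).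
      by rewrite (negbTE (arc_asym xu)) xu (@arcC _ v u) ?vu // eq_sym.
    split=> [u|u w]; rewrite !inE; case: (eqVneq u v) => [->|uv] //=.
    + by move=> su; apply: subsetP (dirS u x) _ (f1 u su).
    + by case: (eqVneq w v) => [->|wv] //=; rewrite ?eqxx // => _ sw _; case: (fC w sw wv).
    + by case: (eqVneq w v) => [->|wv] //= su sw uw; [case: (fC u su uv) | apply: f2].
  - right; exists u, w, A, B; rewrite !inE su sw !orbT.
    rewrite (subset_trans sA) ?(subset_trans sB) //= expnS mulnA.
    by split.
rewrite negb_exists_in => /forall_inP nogood; right.
have Cv0 : 0 < #|C v|.
  by have := mC v (mem_head _ _); case: #|C v| => //; rewrite muln0 leqNgt m0.
(* Every [x] in [C v] fails for some [u]. The most frequent [u] gives a part [A0] of [C v] that is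
   sparse towards [C u] in the direction prescribed by [H]. *)
have [x Cx||u] := @pigeonhole _ _ [set u in s] (C v) (fun u x => M * #|dirN u x| < #|C u|).
- by have /allPn[u su lt_u] := nogood x Cx; exists u; rewrite ?inE // ltnNge.
- by [].
pose A0 : {set T} := [set x in C v | M * #|dirN u x| < #|C u|].
rewrite inE -/A0 => su leC.
have uv : v != u by apply: contraNneq nvs => ->.
have leA0 : #|C v| <= #|H| * #|A0|.
  by apply: leq_trans leC _; rewrite leq_mul2r max_card orbT.
have sA0 : A0 \subset C v by apply/subsetP=> x; rewrite inE => /andP[].
have szA : m <= k * M ^ (size s).+1 * #|H| * #|A0|.
  apply: leq_trans (mC v (mem_head _ _)) _; rewrite -!mulnA leq_mul2l.
  by apply/orP; right; apply: leq_trans leA0 _; rewrite leq_pmull.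
have szC : m <= k * M ^ (size s).+1 * #|H| * #|C u|.
  apply: leq_trans (mC u _) _; first by rewrite inE su orbT.
  rewrite -!mulnA leq_mul2l; apply/orP; right.
  by rewrite mulnA leq_pmull // muln_gt0 M0'.
case vu: (tarc v u).
  exists u, v, (C u), A0; rewrite !inE su eqxx orbT eq_sym; split=> //.
  rewrite /back_arcs big_distrr /= mulnC -sum_nat_const; apply: leq_sum => x.
  by rewrite inE /dirN vu => /andP[_ /ltnW].
exists v, u, A0, (C u); rewrite !inE su eqxx orbT; split=> //.
rewrite back_arcsE big_distrr /= -sum_nat_const; apply: leq_sum => x.
by rewrite inE /dirN vu => /andP[_ /ltnW].
Qed.

(** Injectivity is automatic: distinct vertices are joined by an arc, while no vertex has an arc to
    itself. *)
Lemma contains_of_mono (T H : tournament) (f : H -> T) :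
  (forall u v, u != v -> tarc (f u) (f v) = tarc u v) -> contains T H.
Proof.
move=> fH; exists f; split.
  move=> u v fuv; apply/eqP; apply: contraT => uv.
  have := tarc_total uv; rewrite -fH // -fH 1?eq_sym // fuv tarc_irr.
  by [].
move=> u v; case: (eqVneq u v) => [->|]; first by rewrite !tarc_irr.
exact: fH.
Qed.

(** The greedy embedding is started from disjoint equal parts of [Y], one for each vertex of [H];
    without a copy of [H], only its sparse outcome remains. *)
Lemma sparse_pair (H : tournament) (M : nat) : 0 < M -> exists N, 0 < N /\
  forall T : tournament, ~ contains T H -> forall Y : {set T},
  0 < #|Y| -> #|H| <= #|Y| -> exists A B : {set T},
  [/\ A \subset Y, B \subset Y, [disjoint A & B],
      #|Y| <= N * #|A| /\ #|Y| <= N * #|B| &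
      M * back_arcs A B <= #|A| * #|B|].
Proof.
move=> M0; exists (2 * #|H| * (M ^ #|H| * #|H|)).+1; split=> // T nH Y.
case/card_gt0P=> x0 Yx0 leY.
have [H0|H0] := posnP #|H|.
  case: nH; apply: (@contains_of_mono _ _ (fun _ => x0)) => u.
  by have := fintype0 u; rewrite H0 => /(_ erefl).
pose m := #|Y| %/ #|H|.
have m0 : 0 < m by rewrite divn_gt0.
have leYm : #|Y| <= 2 * #|H| * m.
  have := ltn_ceil #|Y| H0; rewrite -/m => /ltnW/leq_trans; apply.
  by rewrite mulnAC leq_mul2r; lia.
have [|C [C1 C2]] := @exists_parts _ _ (enum H) Y m (enum_uniq _).
  by rewrite -cardE mulnC leq_trunc_div.
have [|[f [f1 f2]]|[u [v [A [B [[_ _ uv] sA sB [mA mB] dAB]]]]]] :=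
    @greedy_embedding T H M m x0 (enum H) 1 C M0 m0 isT (enum_uniq _).
- by move=> v sv; have [_ ->] := C1 v sv; rewrite mul1n.
- by case: nH; apply: (@contains_of_mono _ _ f) => u v; apply: f2; rewrite mem_enum.
rewrite !mul1n -cardE in mA mB.
have sz (D : {set T}) : m <= M ^ #|H| * #|H| * #|D| ->
    #|Y| <= (2 * #|H| * (M ^ #|H| * #|H|)).+1 * #|D|.
  move=> leD; apply: leq_trans leYm _; rewrite mulSn.
  apply: leq_trans (leq_addl _ _); rewrite -[X in _ <= X]mulnA.
  by rewrite leq_mul2l leD orbT.
have [sCu _] := C1 u (mem_enum _ u); have [sCv _] := C1 v (mem_enum _ v).
exists A, B; split.
- exact: subset_trans sA sCu.
- exact: subset_trans sB sCv.
- apply: disjointWl sA _; apply: disjointWr sB _; apply: C2 => //; exact: mem_enum.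
- by split; apply: sz.
- exact: dAB.
Qed.

(** The family doubles by recursion inside both members of a sparse pair. The recursion shrinks each
    member by a factor [N] at most, which can multiply the density by [N ^ 2]; hence the pair is
    taken with [M * N ^ 2]. *)
Lemma sparse_family (H : tournament) k : forall M, 0 < M -> exists N n0, 0 < N /\
  forall T : tournament, ~ contains T H -> forall Y : {set T},
  0 < #|Y| -> n0 <= #|Y| -> exists X : nat -> {set T},
  (forall i, i < 2 ^ k -> X i \subset Y /\ #|Y| <= N * #|X i|) /\
  (forall i j, i < j < 2 ^ k -> [disjoint X i & X j] /\
     M * back_arcs (X i) (X j) <= #|X i| * #|X j|).
Proof.
elim: k => [|k IHk] M M0.
  exists 1, 0; split=> // T _ Y _ _; exists (fun _ => Y); split=> [i _|[|i] [|j]].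
  - by rewrite mul1n.
  - by rewrite andFb.
  - by rewrite expn0 => /andP[].
  - by [].
  - by rewrite expn0 => /andP[].
have [N [n0 [N0 IH]]] := IHk M M0.
have [|N1 [N10 pair]] := @sparse_pair H (M * N ^ 2).
  by rewrite muln_gt0 M0 expn_gt0 N0.
exists (N1 * N), (maxn #|H| (N1 * n0)); split; first by rewrite muln_gt0 N10.
move=> T nH Y Y0; rewrite geq_max => /andP[leH leY].
have [A [B [sA sB dAB [YA YB] eAB]]] := pair T nH Y Y0 leH.
have big (D : {set T}) : #|Y| <= N1 * #|D| -> 0 < #|D| /\ n0 <= #|D|.
  move=> le_YD; split; last by rewrite -(leq_pmul2l N10) (leq_trans leY).
  by move: (leq_trans Y0 le_YD); rewrite muln_gt0 => /andP[].
have [A0 nA] := big A YA; have [B0 nB] := big B YB.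
have [X [X1 X2]] := IH T nH A A0 nA; have [X' [X1' X2']] := IH T nH B B0 nB.
exists (fun i => if i < 2 ^ k then X i else X' (i - 2 ^ k)).
rewrite expnS mul2n -addnn; split=> [i lti|i j /andP[ij ltj]].
  case: ltnP => ik.
    have [sX cX] := X1 i ik; split; first exact: subset_trans sX sA.
    by apply: leq_trans YA _; rewrite -mulnA leq_mul2l cX orbT.
  have [|sX cX] := X1' (i - 2 ^ k); first by rewrite ltn_subLR.
  split; first exact: subset_trans sX sB.
  by apply: leq_trans YB _; rewrite -mulnA leq_mul2l cX orbT.
case: (ltnP i (2 ^ k)) => ik; case: (ltnP j (2 ^ k)) => jk.
- by apply: X2; rewrite ij.
- have [sX cX] := X1 i ik.
  have [|sX' cX'] := X1' (j - 2 ^ k); first by rewrite ltn_subLR.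
  split; first by apply: disjointWl sX _; apply: disjointWr sX' _.
  rewrite -(@leq_pmul2l (N ^ 2)) ?expn_gt0 ?N0 // mulnCA mulnA.
  apply: (leq_trans (n := #|A| * #|B|)).
    by apply: leq_trans eAB; rewrite leq_mul2l back_arcsS ?orbT.
  by rewrite -mulnn mulnACA leq_mul.
- by move: (leq_ltn_trans ik (ltn_trans ij jk)); rewrite ltnn.
- by apply: X2'; rewrite ltn_sub2r ?ltn_subLR // (leq_ltn_trans ik).
Qed.

(* For x in the s-th and w in the t-th member of a family, the pair x, w is
   joined by a backward arc. *)
Definition wrong (T : tournament) (s t : nat) (x w : T) :=
  if s < t then tarc w x else tarc x w.

Definition bad (T : tournament) (s t : nat) (A : {set T}) (x : T) :=
  [set w in A | wrong s t x w].

Definition smooth (T : tournament) (K L N : nat) (Y : {set T})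
    (X : nat -> {set T}) : Prop :=
  [/\ forall i, i < K -> X i \subset Y /\ #|Y| <= N * #|X i|,
      forall i j, i < K -> j < K -> i != j -> [disjoint X i & X j] &
      forall i j x, i < K -> j < K -> i != j -> x \in X i ->
        L * #|bad i j (X j) x| <= #|X j|].

(** Deleting the exceptional vertices turns average sparseness into sparseness at every vertex. By
    Markov's inequality each [j] costs at most a [1 / (2K)] share of [X i], so half of it survives.
    In [4 * L * K] one factor 2 pays for this, the other for the halving of [X j]. *)
Lemma smooth_structure (H : tournament) K L : 0 < L -> exists N n0, 0 < N /\
  forall T : tournament, ~ contains T H -> forall Y : {set T},
  0 < #|Y| -> n0 <= #|Y| -> exists X, smooth K L N Y X.
Proof.
move=> L0; have [->|K0] := posnP K.
  by exists 1, 0; split=> // T _ Y _ _; exists (fun _ => set0); split.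
have [|N [n0 [N0 fam]]] := @sparse_family H K (4 * L * K).
  by rewrite !muln_gt0 L0 K0.
exists (2 * N), n0; split; first by rewrite muln_gt0.
move=> T nH Y Y0 leY; have [X [X1 X2]] := fam T nH Y Y0 leY.
have ltK i : i < K -> i < 2 ^ K by move=> /ltn_trans; apply; apply: ltn_expl.
have X0 i : i < K -> 0 < #|X i|.
  move=> /ltK/X1[_ leX]; move: (leq_trans Y0 leX).
  by rewrite muln_gt0 => /andP[].
pose X' i := [set x in X i |
  [forall j : 'I_K, (i != j) ==> (2 * L * #|bad i j (X j) x| <= #|X j|)]].
have sX' i : X' i \subset X i by apply/subsetP=> x; rewrite inE => /andP[].
have sum_bad i j : i < K -> j < K -> i != j ->
    4 * L * K * \sum_(x in X i) #|bad i j (X j) x| <= #|X i| * #|X j|.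
  move=> iK jK; rewrite neq_ltn => /orP[ij|ji].
    have [|_] := X2 i j; first by rewrite ij ltK.
    by rewrite back_arcsE /bad /wrong ij /inN.
  have [|_] := X2 j i; first by rewrite ji ltK.
  by rewrite /back_arcs /bad /wrong ltnNge (ltnW ji) /= mulnC [X in _ <= X]mulnC mulnC.
have cX' i : i < K -> #|X i| <= 2 * #|X' i|.
  move=> iK.
  pose R (j : 'I_K) := [set x in X i | (i != j) && (#|X j| < 2 * L * #|bad i j (X j) x|)].
  have cR j : 2 * K * #|R j| <= #|X i|.
    case: (eqVneq i j) => [ij|ij].
      rewrite [R j](_ : _ = set0) ?cards0 ?muln0 //.
      by apply/setP=> x; rewrite !inE ij eqxx andbF.
    have := @markov_card _ (X i) (fun x => 2 * L * #|bad i j (X j) x|) #|X j|.+1.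
    rewrite -big_distrr /=.
    have -> : [set x in X i | #|X j| < 2 * L * #|bad i j (X j) x|] = R j.
      by apply/setP=> x; rewrite !inE ij.
    have := sum_bad i j iK (ltn_ord j) ij.
    set Sg := \sum_(x in X i) _ => h1 h2.
    rewrite -(leq_pmul2r (X0 j (ltn_ord j))); apply: leq_trans h1.
    have h3 : #|R j| * #|X j| <= 2 * L * Sg.
      by apply: leq_trans h2; rewrite leq_mul2l leqnSn orbT.
    have := leq_mul (leqnn (2 * K)) h3.
    by rewrite mulnA => /leq_trans; apply; rewrite eq_leq //; ring.
  have : #|X i| <= #|X' i| + #|\bigcup_(j < K) R j|.
    apply/leq_cardD/subsetP=> x Xx; rewrite !inE Xx /=.
    case: (boolP [forall j, _]) => //=; rewrite negb_forall => /existsP[j].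
    rewrite negb_imply -ltnNge => /andP[ij lt_j].
    by apply/bigcupP; exists j => //; rewrite inE Xx ij.
  have : 2 * #|\bigcup_(j < K) R j| <= #|X i|.
    rewrite -(leq_pmul2l K0) mulnA -(mulnC 2).
    have : #|\bigcup_(j < K) R j| <= \sum_(j < K) #|R j|.
      exact: leq_card_bigcup.
    move/(leq_mul (leqnn (2 * K)))/leq_trans; apply.
    rewrite big_distrr /= -[X in _ <= X * _](card_ord K) -sum_nat_const.
    by apply: leq_sum => j _; apply: cR.
  by lia.
exists X'; split=> [i iK|i j iK jK ij|i j x iK jK ij].
- have [sX leX] := X1 i (ltK i iK); split; first exact: subset_trans (sX' i) sX.
  by apply: leq_trans leX _; rewrite -mulnA mulnCA leq_mul2l cX' ?orbT.
- apply: disjointWl (sX' i) _; apply: disjointWr (sX' j) _.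
  move: ij; rewrite neq_ltn => /orP[ij|ji].
    by have [] := X2 i j; rewrite ?ij ?ltK.
  by rewrite disjoint_sym; have [] := X2 j i; rewrite ?ji ?ltK.
rewrite inE => /andP[Xx /forallP/(_ (Ordinal jK))]; rewrite ij /= => le_bad.
have : #|bad i j (X' j) x| <= #|bad i j (X j) x|.
  apply/subset_leq_card/subsetP=> w; rewrite !inE.
  by case/andP=> /andP[-> _] ->.
move/(leq_mul (leqnn L)) => h1.
have := cX' j jK; move: le_bad; rewrite -mulnA; lia.
Qed.

End Smooth.

(** * Embedding a tournament group by group *)

Section GroupEmbedding.
Variables Q T : tournament.
Implicit Types (u v : Q) (x w : T).

Definition agrees u v x w := if tarc u v then tarc x w else tarc w x.

Lemma agreesE u v x w : u != v -> agrees u v x w ->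
  tarc x w = tarc u v /\ tarc w x = tarc v u.
Proof.
move=> uv; rewrite /agrees (arcC uv).
by case: ifP => _ xw; rewrite xw (negbTE (arc_asym xw)).
Qed.

Lemma agreesC u v x w : u != v -> agrees u v x w = agrees v u w x.
Proof. by move=> uv; rewrite /agrees (arcC uv); case: (tarc u v). Qed.

(* The groups of grp are embedded one after the other; delta v bounds what the
   choice of one vertex in another group takes away from the candidates of v. *)
Lemma group_embedding (I : eqType) (grp : Q -> I) (x0 : T) (D : {set Q})
    (C : Q -> {set T}) (delta : Q -> nat) :
  (forall i (C' : Q -> {set T}),
    (forall v, v \in D -> grp v = i ->
       C' v \subset C v /\ #|C v| <= #|C' v| + #|D| * delta v) ->
    exists f : Q -> T,
    [/\ forall v, v \in D -> grp v = i -> f v \in C' v,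
        forall u v, u \in D -> v \in D -> grp u = i -> grp v = i -> u != v ->
          agrees u v (f u) (f v) &
        forall u v, u \in D -> v \in D -> grp u = i -> grp v <> i ->
          #|[set w in C v | ~~ agrees u v (f u) w]| <= delta v]) ->
  exists f : Q -> T, {in D, forall v, f v \in C v} /\
    {in D &, forall u v, u != v -> agrees u v (f u) (f v)}.
Proof.
move=> step.
(* [R] holds the vertices still to be placed; every vertex of [D] outside [R] may have cost [C' v]
   up to [delta v] elements. *)
suff ind : forall n (R : {set Q}) (C' : Q -> {set T}), #|R| <= n -> R \subset D ->
    {in R & D, forall u v, grp u = grp v -> v \in R} ->
    {in R, forall v, C' v \subset C v /\
       #|C v| <= #|C' v| + (#|D| - #|R|) * delta v} ->
    exists f : Q -> T, {in R, forall v, f v \in C' v} /\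
      {in R &, forall u v, u != v -> agrees u v (f u) (f v)}.
  have [||f fP] := ind #|D| D C (leqnn _) (subxx _); last by exists f.
  - by [].
  - by move=> v _; rewrite subxx leq_addr.
elim=> [|n IHn] R C' leR sRD clR CC'.
  move: leR; rewrite leqn0 cards_eq0 => /eqP->.
  by exists (fun _ => x0); split=> u; rewrite inE.
have [->|[v0 Rv0]] := set_0Vmem R.
  by exists (fun _ => x0); split=> u; rewrite inE.
pose i := grp v0; pose G := [set u in R | grp u == i].
have GR v : v \in D -> grp v = i -> v \in R.
  by move=> Dv gv; apply: clR Rv0 Dv _; rewrite gv.
have sGR : G \subset R by apply/subsetP=> u; rewrite inE => /andP[].
have cGR : #|R :\: G| = #|R| - #|G| by rewrite cardsD (setIidPr sGR).
have leRD := subset_leq_card sRD.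
have [v Dv gv|f0 [f01 f02 f03]] := step i C'.
  have [sC leC] := CC' v (GR v Dv gv); split=> //.
  by apply: leq_trans leC _; rewrite leq_add2l leq_mul2r leq_subr orbT.
pose C2 v := C' v :\: \bigcup_(u in G) [set w in C v | ~~ agrees u v (f0 u) w].
have leRG : #|R :\: G| <= n.
  rewrite -ltnS; apply: leq_trans leR; apply/proper_card/properP.
  by split; [exact: subsetDl | exists v0; rewrite // !inE Rv0 eqxx].
have [||f1 [f11 f12]] := IHn (R :\: G) C2 leRG (subset_trans (subsetDl _ _) sRD).
- move=> u v; rewrite !inE => /andP[nGu Ru] Dv guv; rewrite (clR u v Ru Dv guv).
  by move: nGu; rewrite Ru guv /= => ->.
- move=> v; rewrite !inE => /andP[nGv Rv]; have [sC leC] := CC' v Rv.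
  split; first exact: subset_trans (subsetDl _ _) sC.
  have gvi : grp v <> i by move: nGv; rewrite Rv /= => /eqP.
  have le2 : #|C' v| <= #|C2 v| + #|G| * delta v.
    rewrite -sum_nat_const.
    apply: leq_trans (leq_cardD (_ : _ \subset C2 v :|:
       \bigcup_(u in G) [set w in C v | ~~ agrees u v (f0 u) w])) _.
      by apply/subsetP=> w C'w; rewrite !inE C'w andbT orNb.
    rewrite leq_add2l.
    apply: (leq_trans (n := \sum_(u in G) #|[set w in C v | ~~ agrees u v (f0 u) w]|)).
      exact: leq_card_bigcup.
    apply: leq_sum => u; rewrite inE => /andP[Ru /eqP gu].
    by apply: f03; rewrite ?(subsetP sRD).
  apply: leq_trans leC _; rewrite cGR.
  apply: leq_trans (leq_add le2 (leqnn _)) _.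
  rewrite -addnA leq_add2l -mulnDl leq_mul2r; apply/orP; right.
  by have := subset_leq_card sGR; lia.
have gG u : u \in R -> grp u <> i -> u \in R :\: G.
  by move=> Ru /eqP gu; rewrite !inE Ru andbT (negbTE gu).
have cross u v : u \in R -> v \in R -> grp u = i -> grp v <> i ->
    agrees u v (f0 u) (f1 v).
  move=> Ru Rv gu gv; have := f11 v (gG v Rv gv).
  rewrite inE => /andP[/bigcupP nG C'v]; apply: contraT => nag; case: nG.
  exists u; rewrite inE ?Ru ?gu ?eqxx // nag andbT.
  by have [sC _] := CC' v Rv; apply: subsetP sC _ C'v.
exists (fun v => if grp v == i then f0 v else f1 v); split=> [v Rv|u v Ru Rv uv].
  case: eqP => gv; first by apply: f01 => //; apply: subsetP sRD _ Rv.
  by have := f11 v (gG v Rv gv); rewrite inE => /andP[].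
case: (eqVneq (grp u) i) => [gu|/eqP gu]; case: (eqVneq (grp v) i) => [gv|/eqP gv].
- by apply: f02 => //; apply: subsetP sRD _ _.
- exact: cross.
- by rewrite agreesC // cross.
- by apply: f12 => //; apply: gG.
Qed.

End GroupEmbedding.

(** * Tight sets and the embedding of stars *)

Definition tight (T : tournament) (N D : nat) (Y : {set T}) :=
  forall Z : {set T}, Z \subset Y -> #|Y| <= N * #|Z| -> D * tr Y < D * tr Z + tr Y.

Lemma wrongC (T : tournament) s t (x w : T) :
  s != t -> wrong s t x w = wrong t s w x.
Proof. by rewrite /wrong; case: ltngtP. Qed.

(* Otherwise a linear part of A and one of the transitive sets B v would
   together form a transitive set larger than tr Y. *)
Lemma tight_star (I : finType) (T : tournament) (Y A : {set T}) (Lf : {set I})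
    (B : I -> {set T}) (N0 h s t : nat) :
  tight (8 * h * N0) (16 * h) Y -> A \subset Y -> 0 < #|A| ->
  #|Y| <= 2 * N0 * #|A| -> #|Lf| <= h ->
  (forall v, v \in Lf -> [/\ B v \subset Y, trans_set (B v),
     tr Y <= 16 * h * #|B v| & [disjoint A & B v]]) ->
  exists2 x, x \in A &
    forall v, v \in Lf -> exists2 w, w \in B v & wrong s t x w.
Proof.
move=> tY sAY A0 leYA leLf BP.
case: (boolP [exists x in A, [forall v in Lf, [exists w in B v, wrong s t x w]]]).
  case/exists_inP=> x Ax /forall_inP xP; exists x => // v Lv.
  by have /exists_inP[w Bw xw] := xP v Lv; exists w.
rewrite negb_exists_in => /forall_inP noA.
have [x Ax||v Lv leA] := @pigeonhole _ _ Lf A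
    (fun v x => [forall w in B v, ~~ wrong s t x w]).
- have /forall_inPn[v Lv] := noA x Ax; rewrite negb_exists_in => Pv.
  by exists v.
- by [].
pose Av : {set T} := [set x in A | [forall w in B v, ~~ wrong s t x w]].
rewrite -/Av in leA.
have sAvA : Av \subset A by apply/subsetP=> x; rewrite inE => /andP[].
have sAvY := subset_trans sAvA sAY.
have [sBY trB leB dAB] := BP v Lv.
have leYv : #|Y| <= 8 * h * N0 * #|Av|.
  apply: leq_trans leYA _; apply: (leq_trans (n := 2 * N0 * (h * #|Av|))).
    by rewrite leq_mul2l (leq_trans leA) ?orbT // leq_mul2r leLf orbT.
  have -> : 2 * N0 * (h * #|Av|) = 2 * (h * N0 * #|Av|) by ring.
  have -> : 8 * h * N0 * #|Av| = 8 * (h * N0 * #|Av|) by ring.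
  by rewrite leq_mul2r orbT.
have ltY := tY Av sAvY leYv.
have le_sum : tr Av + #|B v| <= tr Y.
  rewrite -(tr_trans trB).
  have dxw x w : x \in Av -> w \in B v -> x != w.
    move=> /(subsetP sAvA) Ax Bw; apply: contraTneq dAB => xw.
    by rewrite -setI_eq0; apply/set0Pn; exists x; rewrite inE Ax xw.
  have noW x w : x \in Av -> w \in B v -> ~~ wrong s t x w.
    by rewrite inE => /andP[_ /forall_inP noW] /noW.
  case st: (s < t).
    apply: tr_fwd => //; apply/fwdP=> x w Ax Bw.
    have := noW x w Ax Bw; rewrite /wrong st.
    by rewrite (arcC (dxw x w Ax Bw)) negbK.
  rewrite addnC; apply: tr_fwd => //; apply/fwdP=> w x Bw Ax.
  have := noW x w Ax Bw; rewrite /wrong st.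
  by rewrite -(arcC (dxw x w Ax Bw)).
(* By tightness [tr Av] falls short of [tr Y] by less than [tr Y / (16 h)], and [B v] has at least
   that size. *)
have := leq_mul (leqnn (16 * h)) le_sum.
by rewrite mulnDr; lia.
Qed.

(* Embedding data for a union D of stars: slot v is the index of the linear set
   receiving v, ctr v the center of the star of v, run v the slot holding the
   leaves of that star, and pos v the rank of v in the ordering. *)
Record star_plan (Q : tournament) (D : {set Q}) (slot run pos : Q -> nat)
    (ctr : Q -> Q) (h : nat) : Prop := StarPlan {
  plan_card : #|Q| <= h;
  plan_pos : forall v, pos v < h;
  plan_ctrD : forall v, v \in D -> ctr v \in D;
  plan_ctrK : forall v, v \in D -> ctr (ctr v) = ctr v;
  plan_run : forall v, v \in D -> run (ctr v) = run v;
  plan_leaf : forall v, v \in D -> ctr v != v ->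
    [/\ run v = slot v, slot (ctr v) != slot v &
        tarc v (ctr v) = (slot (ctr v) < slot v)];
  plan_center : forall v, v \in D -> run v != slot v ->
    {in D, forall u, slot u = slot v -> u = v} /\
    exists2 u, u \in D & ctr u = v /\ u != v;
  plan_fwd : {in D &, forall u v, ctr u != ctr v -> slot u < slot v -> tarc u v};
  plan_slot : {in D &, forall u v, slot u = slot v -> u != v ->
    pos u != pos v /\ (pos u < pos v -> tarc u v)} }.

Section StarEmbedding.
Variables (Q : tournament) (D : {set Q}) (slot run pos : Q -> nat) (ctr : Q -> Q).
Variables (h L N0 : nat) (T : tournament) (Y : {set T}) (X C : nat -> {set T}).
Hypothesis plan : star_plan D slot run pos ctr h.
Hypothesis leL : 32 * h ^ 2 <= L.
Hypothesis C_sub : {in D, forall v,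
  C (slot v) \subset X (slot v) /\ 3 * #|X (slot v)| <= 4 * #|C (slot v)|}.
Hypothesis X_lin : {in D, forall v,
  X (slot v) \subset Y /\ #|Y| <= N0 * #|X (slot v)|}.
Hypothesis X_disj : {in D &, forall u v, slot u != slot v ->
  [disjoint X (slot u) & X (slot v)]}.
Hypothesis X_bad : {in D &, forall u v x, slot u != slot v -> x \in X (slot u) ->
  L * #|bad (slot u) (slot v) (X (slot v)) x| <= #|X (slot v)|}.
Hypothesis Y_tight : tight (8 * h * N0) (16 * h) Y.
Hypothesis Y_big : 16 * h <= tr Y.
Hypothesis D0 : D != set0.

Lemma plan_h_gt0 : 0 < h.
Proof.
have [v _] := set0Pn _ D0; exact: leq_ltn_trans (leq0n _) (plan_pos plan v).
Qed.

Lemma L_gt0 : 0 < L.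
Proof. by apply: leq_trans leL; rewrite muln_gt0 expn_gt0 plan_h_gt0. Qed.

Let delta v := #|X (slot v)| %/ L.

Lemma delta_small v : 32 * h * (h * delta v) <= #|X (slot v)|.
Proof.
apply: leq_trans (leq_trunc_div _ L); rewrite mulnC -/(delta v).
by have := leq_mul leL (leqnn (delta v)); rewrite -mulnn; lia.
Qed.

Lemma Y_gt0 : 0 < #|Y|.
Proof.
rewrite -tr_gt0; apply: leq_trans Y_big; by rewrite muln_gt0 plan_h_gt0.
Qed.

Lemma X_gt0 v : v \in D -> 0 < #|X (slot v)|.
Proof.
move=> Dv; have [_ le] := X_lin Dv; have := leq_trans Y_gt0 le.
by rewrite muln_gt0 => /andP[].
Qed.

Lemma not_agrees_wrong u v x w : u \in D -> v \in D -> ctr u != ctr v ->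
  slot u != slot v -> x \in X (slot u) -> w \in X (slot v) ->
  ~~ agrees u v x w -> wrong (slot u) (slot v) x w.
Proof.
move=> Du Dv cuv suv Xx Xw; rewrite /agrees /wrong.
have xw : x != w.
  apply: contraTneq (X_disj Du Dv suv) => xw.
  by rewrite -setI_eq0; apply/set0Pn; exists x; rewrite inE Xx xw.
have uv : u != v by apply: contraNneq cuv => ->.
case: ltngtP suv => // [ltuv|ltvu] _.
  by rewrite (plan_fwd plan Du Dv cuv ltuv) (arcC xw).
have vu : tarc v u by apply: (plan_fwd plan) => //; rewrite eq_sym.
by rewrite (negbTE (arc_asym vu)) (arcC xw) negbK.
Qed.

Lemma not_agrees_card u v x (E : {set T}) : u \in D -> v \in D ->
  ctr u != ctr v -> slot u != slot v -> x \in X (slot u) -> E \subset X (slot v) ->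
  #|[set w in E | ~~ agrees u v x w]| <= delta v.
Proof.
move=> Du Dv cuv suv Xx /subsetP sE; rewrite leq_divRL ?L_gt0 // mulnC.
apply: leq_trans (X_bad Du Dv suv Xx); rewrite leq_mul2l; apply/orP; right.
apply/subset_leq_card/subsetP=> w; rewrite !inE => /andP[/sE Xw].
by rewrite Xw; apply: not_agrees_wrong.
Qed.

Lemma wrong_agrees v (x w : T) : v \in D -> ctr v != v ->
  wrong (slot (ctr v)) (slot v) x w -> agrees (ctr v) v x w.
Proof.
move=> Dv cv; have [_ _ vc] := plan_leaf plan Dv cv.
rewrite /wrong /agrees (arcC (_ : v != ctr v)) 1?eq_sym // vc.
by case: ltnP.
Qed.

Section OneRun.
Variables (i : nat) (C' : Q -> {set T}).
Let G := [set v in D | run v == i].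
Hypothesis C'_sub : {in G, forall v, C' v \subset C (slot v) /\
  #|C (slot v)| <= #|C' v| + #|D| * delta v}.

Lemma G_slot : G != set0 -> exists2 v, v \in G & slot v = i.
Proof.
case/set0Pn=> v Gv; have := Gv; rewrite inE => /andP[Dv /eqP rv].
case: (eqVneq (run v) (slot v)) => [e|rsv]; first by exists v; rewrite -?e.
have [_ [u Du [cu uv]]] := plan_center plan Dv rsv.
have cuu : ctr u != u by rewrite cu eq_sym.
have [ru _ _] := plan_leaf plan Du cuu.
have riu : run u = i by rewrite -(plan_run plan Du) cu.
by exists u; rewrite ?inE ?Du ?riu ?eqxx // -ru.
Qed.

(** The candidates common to all vertices of the run with slot [i] still make up half of [X i], so
    tightness gives them nearly the full [tr Y]. One transitive set can then host all leaves of the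
    run. *)
Lemma run_transitive_set : G != set0 ->
  exists S, [/\ trans_set S, tr Y <= 2 * #|S| &
    forall v, v \in G -> slot v = i -> S \subset C' v].
Proof.
move=> /G_slot[v0 Gv0 sv0]; have Dv0 : v0 \in D by move: Gv0; rewrite inE => /andP[].
pose M := [set v in G | slot v == i].
pose A := C i :\: \bigcup_(v in M) (C i :\: C' v).
have leM : #|M| <= h.
  exact: leq_trans (leq_trans (max_card _) (leqnn _)) (plan_card plan).
have leD : #|D| <= h by apply: leq_trans (max_card _) (plan_card plan).
have leCA : #|C i| <= #|A| + h * (h * delta v0).
  apply: leq_trans (leq_cardD (_ : _ \subset A :|: \bigcup_(v in M) (C i :\: C' v))) _.
    by apply/subsetP=> w Cw; rewrite !inE Cw andbT orNb.
  rewrite leq_add2l.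
  apply: (leq_trans (n := \sum_(v in M) #|C i :\: C' v|)).
    exact: leq_card_bigcup.
  apply: (leq_trans (n := \sum_(v in M) h * delta v0)).
    apply: leq_sum => v; rewrite inE => /andP[Gv /eqP sv].
    have [sC leC] := C'_sub Gv; rewrite -sv cardsD (setIidPr sC) leq_subLR.
    apply: leq_trans leC _; rewrite leq_add2l /delta sv0 sv.
    by rewrite leq_mul2r leD orbT.
  by rewrite sum_nat_const leq_mul2r leM orbT.
have [sCX leCX] := C_sub Dv0; have [sXY leYX] := X_lin Dv0.
have dl := delta_small v0; rewrite sv0 in sCX leCX sXY leYX dl.
have leXA : #|X i| <= 2 * #|A|.
  by have := plan_h_gt0; move: dl leCA leCX; rewrite -mulnA; case: (h) => // n; lia.
have sAC : A \subset C i by apply: subsetDl.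
have sAY : A \subset Y by apply: subset_trans sAC (subset_trans sCX sXY).
have ltY : 16 * h * tr Y < 16 * h * tr A + tr Y.
  apply: Y_tight => //; apply: leq_trans leYX _.
  apply: (leq_trans (n := N0 * (2 * #|A|))); first by rewrite leq_mul2l leXA orbT.
  have -> : N0 * (2 * #|A|) = 2 * (N0 * #|A|) by ring.
  have -> : 8 * h * N0 * #|A| = (8 * h) * (N0 * #|A|) by ring.
  by rewrite leq_mul2r; have := plan_h_gt0; lia.
have [S [sSA trS cS]] := tr_witness A.
exists S; split=> //.
  rewrite cS leqNgt; apply/negP=> lt2.
  have := leq_mul (leqnn h) (ltnW lt2).
  by have := leq_mul plan_h_gt0 (leqnn (tr Y)); move: ltY; lia.
move=> v Gv sv; apply: subset_trans sSA _; apply/subsetP=> w.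
rewrite inE => /andP[/bigcupP nM Cw]; apply: contraT => nC'; case: nM.
by exists v; [rewrite inE Gv sv eqxx | rewrite inE nC' Cw].
Qed.

(** Smoothness bounds the backward arcs from a vertex into a linear set, but the leaves go into [S],
    whose size is only comparable to [tr Y]. So the centers are restricted to vertices with [few]
    backward arcs to [S], and double counting shows that most candidates qualify. *)
Lemma run_embedding (x0 : T) : exists f : Q -> T,
  {in G, forall v, f v \in C' v} /\
  {in G &, forall u v, u != v -> agrees u v (f u) (f v)}.
Proof.
have [G0|Gn0] := eqVneq G set0.
  by exists (fun _ => x0); rewrite G0; split=> u; rewrite inE.
have [S [trS leYS sSC']] := run_transitive_set Gn0.
have h0 := plan_h_gt0.
have GD v : v \in G -> v \in D by rewrite inE => /andP[].
have Gr v : v \in G -> run v = i by rewrite inE => /andP[_ /eqP].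
have leG : #|G| <= h by apply: leq_trans (max_card _) (plan_card plan).
have leD : #|D| <= h by apply: leq_trans (max_card _) (plan_card plan).
have cardS : 8 * h <= #|S| by move: Y_big leYS; lia.
pose wd := #|S| %/ h.
have [|Sg [Sg1 Sg2]] := @trans_set_segments _ h S wd trS; first by rewrite mulnC leq_trunc_div.
(* At most [h] vertices each spoil [#|S| / (4 h ^ 2)] elements, together about a quarter of a
   segment of size [#|S| / h]. *)
pose few s x := 4 * h ^ 2 * #|bad s i S x| <= #|S|.
pose Cc v := if slot v == i then Sg (pos v) else [set x in C' v | few (slot v) x].
pose dl v := if slot v == i then #|S| %/ (4 * h ^ 2) else delta v.
have sCc v : v \in G -> Cc v \subset C' v.
  rewrite /Cc => Gv; case: eqP => sv; last by apply/subsetP=> x; rewrite inE => /andP[].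
  by have [sS _] := Sg1 (pos v) (plan_pos plan v); apply: subset_trans sS (sSC' v Gv sv).
have sC'X v : v \in G -> C' v \subset X (slot v).
  move=> Gv; have [sC _] := C'_sub Gv; have [sX _] := C_sub (GD v Gv).
  exact: subset_trans sC sX.
have sCcX v : v \in G -> Cc v \subset X (slot v).
  by move=> Gv; apply: subset_trans (sCc v Gv) (sC'X v Gv).
have sSX : S \subset X i.
  have [v Gv sv] := G_slot Gn0.
  by rewrite -sv; apply: subset_trans (sSC' v Gv sv) (sC'X v Gv).
suff: exists f : Q -> T, {in G, forall v, f v \in Cc v} /\
    {in G &, forall u v, u != v -> agrees u v (f u) (f v)}.
  by case=> f [f1 f2]; exists f; split=> // v Gv; apply: subsetP (sCc v Gv) _ (f1 v Gv).
have center_unique u v : u \in G -> v \in G -> slot v != i -> slot u = slot v -> u = v.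
  move=> Gu Gv sv suv; have [|uniq _] := plan_center plan (GD v Gv).
    by rewrite (Gr v Gv) eq_sym.
  exact: uniq (GD u Gu) suv.
have seg_agrees u v x w : u \in G -> v \in G -> slot u = i -> slot v = i -> u != v ->
    x \in Cc u -> w \in Cc v -> agrees u v x w.
  move=> Gu Gv su sv uv; rewrite /Cc su sv eqxx => Cx Cw.
  have [puv ltuv] := plan_slot plan (GD u Gu) (GD v Gv) (etrans su (esym sv)) uv.
  have vu : v != u by rewrite eq_sym.
  have [_ ltvu] := plan_slot plan (GD v Gv) (GD u Gu) (etrans sv (esym su)) vu.
  case: ltngtP puv => // [ltp|ltp] _.
    rewrite /agrees (ltuv ltp); have /fwdP-> // : fwd (Sg (pos u)) (Sg (pos v)).
    by apply: Sg2; rewrite ltp (plan_pos plan).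
  rewrite /agrees (negbTE (arc_asym (ltvu ltp))).
  have /fwdP-> // : fwd (Sg (pos v)) (Sg (pos u)).
  by apply: Sg2; rewrite ltp (plan_pos plan).
have cross u v x : u \in G -> v \in G -> ctr u <> ctr v -> x \in Cc u ->
    #|[set w in Cc v | ~~ agrees u v x w]| <= dl v.
  move=> Gu Gv /eqP cuv Cx; have uv : u != v by apply: contraNneq cuv => ->.
  have Xx := subsetP (sCcX u Gu) x Cx.
  case: (eqVneq (slot v) i) => sv; last first.
    rewrite /dl (negbTE sv); apply: not_agrees_card => //; try exact: GD.
    - by apply: contraNneq uv => /(center_unique u v Gu Gv sv)->.
    - exact: sCcX.
  case: (eqVneq (slot u) i) => su.
    rewrite (_ : [set w in _ | _] = set0) ?cards0 //; apply/setP=> w; rewrite !inE.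
    by apply/negP=> /andP[Cw /negP[]]; apply: seg_agrees.
  have [sSg _] := Sg1 (pos v) (plan_pos plan v).
  have fewx : few (slot u) x by move: Cx; rewrite /Cc (negbTE su) inE => /andP[].
  rewrite /dl sv eqxx leq_divRL ?muln_gt0 ?expn_gt0 ?h0 // mulnC.
  apply: leq_trans fewx; rewrite leq_mul2l; apply/orP; right.
  apply/subset_leq_card/subsetP=> w; rewrite 2!inE => /andP[Cw nag].
  have Sw : w \in S by apply: subsetP sSg _ _; move: Cw; rewrite /Cc sv eqxx.
  rewrite Sw /= -sv; apply: not_agrees_wrong nag; try exact: GD; rewrite ?sv //.
  exact: subsetP sSX _ Sw.
have seg_big v (B : {set T}) : v \in G -> slot v = i ->
    #|Cc v| <= #|B| + #|G| * dl v -> tr Y <= 16 * h * #|B|.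
  move=> Gv sv; rewrite /Cc /dl sv eqxx; have [_ ->] := Sg1 (pos v) (plan_pos plan v).
  have := ltn_ceil #|S| h0; rewrite -/wd; have := leq_trunc_div #|S| (4 * h ^ 2).
  set ds := #|S| %/ _ => le1 le2 le3.
  have := leq_mul (leqnn h) (leq_trans le3 (leq_add (leqnn _) (leq_mul leG (leqnn ds)))).
  by move: le1 le2 leYS Y_big; rewrite -mulnn; lia.
have center_big v (B : {set T}) : v \in G -> slot v != i ->
    #|Cc v| <= #|B| + #|G| * dl v -> #|X (slot v)| <= 2 * #|B|.
  move=> Gv sv; rewrite /Cc /dl (negbTE sv) => leB.
  have Dv := GD v Gv; have [_ leC'] := C'_sub Gv; have [_ leC] := C_sub Dv.
  pose R := [set x in X (slot v) | #|S| < 4 * h ^ 2 * #|bad (slot v) i S x|].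
  (* Smoothness is applied from the vertices of [S] into [X (slot v)], and the count is then
     reversed; [L >= 32 h ^ 2] leaves an eighth of exceptional vertices. *)
  have leR : 8 * #|R| <= #|X (slot v)|.
    have S0 : 0 < #|S| by apply: leq_trans cardS; rewrite muln_gt0 h0.
    have [v1 Gv1 sv1] := G_slot Gn0.
    have := @markov_card _ (X (slot v)) (fun x => 4 * h ^ 2 * #|bad (slot v) i S x|) #|S|.+1.
    rewrite -/R -big_distrr /= /bad (sum_card_exchange _ _ (wrong (slot v) i)) => le1.
    have le2 : L * \sum_(w in S) #|[set x in X (slot v) | wrong (slot v) i x w]|
        <= #|S| * #|X (slot v)|.
      rewrite big_distrr /= -sum_nat_const; apply: leq_sum => w Sw.
      have sv1v : slot v1 != slot v by rewrite sv1 eq_sym.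
      have Xw : w \in X (slot v1) by rewrite sv1; apply: subsetP sSX _ Sw.
      apply: leq_trans (X_bad (GD _ Gv1) Dv sv1v Xw).
      rewrite leq_mul2l; apply/orP; right; apply/subset_leq_card/subsetP=> x.
      by rewrite !inE sv1 wrongC.
    set Sm := \sum_(w in S) _ in le1 le2.
    have hh : 0 < 4 * h ^ 2 by rewrite muln_gt0 expn_gt0 h0.
    rewrite -(leq_pmul2r S0) -(leq_pmul2l hh).
    have le3 := leq_mul leL (leqnn Sm).
    have le4 : #|R| * #|S| <= 4 * h ^ 2 * Sm.
      by apply: leq_trans le1; rewrite leq_mul2l leqnSn orbT.
    have le5 := leq_mul (leqnn (4 * h ^ 2)) le4.
    have le6 : 4 * h ^ 2 * (8 * #|R| * #|S|) <= 4 * h ^ 2 * (32 * h ^ 2 * Sm).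
      apply: leq_trans (_ : 8 * (4 * h ^ 2 * (4 * h ^ 2 * Sm)) <= _).
        by apply: leq_trans (leq_mul (leqnn 8) le5); rewrite eq_leq //; ring.
      by rewrite eq_leq //; ring.
    apply: leq_trans le6 _; rewrite leq_mul2l; apply/orP; right.
    by apply: leq_trans le3 (leq_trans le2 _); rewrite mulnC.
  have leCR : #|C' v| <= #|[set x in C' v | few (slot v) x]| + #|R|.
    apply/leq_cardD/subsetP=> x C'x; rewrite !inE C'x (subsetP (sC'X v Gv)) //= /few.
    by case: leqP.
  have dsm := delta_small v.
  have leDd := leq_mul leD (leqnn (delta v)); have leGd := leq_mul leG (leqnn (delta v)).
  have := leq_mul h0 (leqnn (h * delta v)); move: dsm; rewrite -!mulnA.
  by lia.
(* Second level of grouping: inside a run, a group is a single star, named by its center. *)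
have [|f [f1 f2]] := @group_embedding Q T Q ctr x0 G Cc dl; last by exists f.
move=> c C3 C3P.
have [Gc|nGc] := boolP ((c \in G) && (ctr c == c)); last first.
  have no v : v \in G -> ctr v <> c.
    move=> Gv cv; case/negP: nGc; rewrite -cv inE (plan_ctrD plan) ?GD //=.
    by rewrite (plan_run plan) ?GD // (Gr v Gv) (plan_ctrK plan) ?GD ?eqxx.
  exists (fun _ => x0); split=> [v Gv /no|u v Gu _ /no|u v Gu _ /no] //.
case/andP: Gc => Gc /eqP cc.
have [sC3 leC3] := C3P c Gc cc.
have leafs v : v \in G -> ctr v = c -> v != c ->
    [/\ slot v = i, slot c != i, ctr v != v & ctr v = c].
  move=> Gv cv vc; have cvv : ctr v != v by rewrite cv eq_sym.
  have [rv sv _] := plan_leaf plan (GD v Gv) cvv.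
  have si : slot v = i by rewrite -rv Gr.
  by rewrite -cv -si.
(* Leaves of the run have slot [i] and never share the slot of their center, so if [c] has slot [i]
   it is alone in its group. *)
case: (eqVneq (slot c) i) => sc.
  have single v : v \in G -> ctr v = c -> v = c.
    move=> Gv cv; apply/eqP; apply: contraT => /(leafs v Gv cv)[_].
    by rewrite sc eqxx.
  have /card_gt0P[w0 Cw0] : 0 < #|C3 c|.
    have := seg_big c (C3 c) Gc sc leC3.
    by case: #|C3 c| => //; rewrite muln0; move: Y_big h0; lia.
  exists (fun _ => w0); split.
  - by move=> v Gv /(single v Gv)->.
  - by move=> u v Gu Gv /(single u Gu)-> /(single v Gv)->; rewrite eqxx.
  - move=> u v Gu Gv /(single u Gu)-> cv.
    by apply: cross => //; [rewrite cc => /esym | apply: subsetP sC3 _ _].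
pose Lf := [set v in G | (ctr v == c) && (v != c)].
have LfP v : v \in Lf -> [/\ v \in G, ctr v = c & v != c].
  by rewrite inE => /and3P[-> /eqP-> ->].
have XC3 := center_big c (C3 c) Gc sc leC3.
have [sXcY leXcY] := X_lin (GD c Gc).
have sC3X v : v \in G -> ctr v = c -> C3 v \subset X (slot v).
  by move=> Gv cv; have [sC _] := C3P v Gv cv; apply: subset_trans sC (sCcX v Gv).
have [||||v Lv|x C3x xP] := @tight_star Q T Y (C3 c) Lf C3 N0 h (slot c) i Y_tight.
- exact: subset_trans (sC3X c Gc cc) sXcY.
- by have := X_gt0 (GD c Gc); lia.
- apply: leq_trans leXcY _; apply: leq_trans (leq_mul (leqnn N0) XC3) _.
  by rewrite eq_leq //; ring.
- by apply: leq_trans (max_card _) (plan_card plan).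
- have [Gv cv vc] := LfP v Lv; have [sC leC] := C3P v Gv cv.
  have [sv _ _ _] := leafs v Gv cv vc.
  have sC3S : C3 v \subset S.
    apply: subset_trans sC _; rewrite /Cc sv eqxx.
    by have [] := Sg1 (pos v) (plan_pos plan v).
  split.
  + by apply: subset_trans (sC3X v Gv cv) _; have [] := X_lin (GD v Gv).
  + exact: trans_setS sC3S trS.
  + exact: seg_big leC.
  + apply: disjointWl (sC3X c Gc cc) _; apply: disjointWr (sC3X v Gv cv) _.
    by apply: X_disj; rewrite ?GD // sv.
pose f v := if v == c then x else odflt x [pick w in C3 v | wrong (slot c) i x w].
have fP v : v \in Lf -> f v \in C3 v /\ wrong (slot c) i x (f v).
  move=> Lv; have [_ _ vc] := LfP v Lv; rewrite /f (negbTE vc).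
  case: pickP => [w /andP[]//|no]; have [w Cw xw] := xP v Lv.
  by have := no w; rewrite Cw xw.
have mem_Lf v : v \in G -> ctr v = c -> v != c -> v \in Lf.
  by move=> Gv cv vc; rewrite inE Gv cv vc eqxx.
have fc : f c = x by rewrite /f eqxx.
have f_in v : v \in G -> ctr v = c -> f v \in C3 v.
  move=> Gv cv; case: (eqVneq v c) => [->|vc]; first by rewrite fc.
  by have [] := fP v (mem_Lf v Gv cv vc).
have f_Cc v : v \in G -> ctr v = c -> f v \in Cc v.
  by move=> Gv cv; have [sC _] := C3P v Gv cv; apply: subsetP sC _ (f_in v Gv cv).
have f_c v : v \in G -> ctr v = c -> v != c -> agrees c v (f c) (f v).
  move=> Gv cv vc; have [sv _ cvv _] := leafs v Gv cv vc.
  have [_] := fP v (mem_Lf v Gv cv vc); rewrite fc -cv -sv.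
  exact: wrong_agrees (GD v Gv) cvv.
exists f; split=> // [u v Gu Gv cu cv uv|u v Gu Gv cu cv].
  case: (eqVneq u c) uv => [->|uc] uv; first by rewrite f_c // eq_sym.
  case: (eqVneq v c) uv => [->|vc] uv; first by rewrite agreesC // f_c.
  have [su _ _ _] := leafs u Gu cu uc; have [sv _ _ _] := leafs v Gv cv vc.
  by apply: seg_agrees => //; apply: f_Cc.
by apply: cross => //; [rewrite cu => /esym | apply: f_Cc].
Qed.

End OneRun.

(** The outer groups are the runs. Vertices of different runs differ in center and in slot, so
    between them forward arcs are wanted and smoothness bounds the loss by [delta]. *)
Lemma star_embedding (x0 : T) : exists f : Q -> T,
  {in D, forall v, f v \in C (slot v)} /\
  {in D &, forall u v, u != v -> agrees u v (f u) (f v)}.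
Proof.
apply: (@group_embedding Q T nat run x0 D (fun v => C (slot v)) delta) => i C' C'P.
have [v|f [f1 f2]] := @run_embedding i C' _ x0.
  by rewrite inE => /andP[Dv /eqP rv]; apply: C'P.
have inG v : v \in D -> run v = i -> v \in [set v in D | run v == i].
  by move=> Dv rv; rewrite inE Dv rv eqxx.
exists f; split=> [v Dv rv|u v Du Dv ru rv|u v Du Dv ru rv].
- by apply: f1; apply: inG.
- by apply: f2; apply: inG.
have rne : run u != run v by rewrite ru eq_sym; apply/eqP.
have Cu : f u \in C (slot u).
  by have [sC _] := C'P u Du ru; apply: subsetP sC _ (f1 u (inG u Du ru)).
have [sCu _] := C_sub Du; have [sCv _] := C_sub Dv.
apply: not_agrees_card => //; last exact: subsetP sCu _ Cu.
  by apply: contraNneq rne => cuv; rewrite -(plan_run plan Du) cuv (plan_run plan).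
apply: contraNneq rne => suv.
case: (eqVneq (run u) (slot u)) => [ru'|ru'].
  case: (eqVneq (run v) (slot v)) => [rv'|rv']; first by rewrite ru' rv' suv.
  by have [uniq _] := plan_center plan Dv rv'; rewrite (uniq u Du suv).
by have [uniq _] := plan_center plan Du ru'; rewrite (uniq v Dv (esym suv)).
Qed.

End StarEmbedding.

(* The tournament on h1, h2, h3, h4, h6 in the alpha-galaxy. *)
Definition five (T : tournament) (p q a b z : T) :=
  [&& tarc p q, tarc p a, tarc b p, tarc p z, tarc q a, tarc q b, tarc q z,
      tarc a b, tarc z a & tarc z b].

Definition good (T : tournament) (Y : {set T}) (z : T) :=
  (z \notin Y) && ~~ [exists p in Y, exists q in Y, exists a in Y, exists b in Y,
                        five p q a b z].

Lemma goodS (T : tournament) (Y Z : {set T}) z : Z \subset Y -> good Y z -> good Z z.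
Proof.
move=> /subsetP sZY /andP[nYz no5]; apply/andP; split.
  by apply: contra nYz; apply: sZY.
apply: contra no5 => /exists_inP[p Zp /exists_inP[q Zq /exists_inP[a Za /exists_inP[b Zb f5]]]].
apply/exists_inP; exists p; first exact: sZY.
apply/exists_inP; exists q; first exact: sZY.
apply/exists_inP; exists a; first exact: sZY.
by apply/exists_inP; exists b; first exact: sZY.
Qed.

(** * Chains of out-neighbourhoods of a good vertex *)

Section Chain.
Variables (T : tournament) (K L N0 h : nat) (Y : {set T}) (X : nat -> {set T}).
Hypothesis h_gt0 : 0 < h.
Hypothesis leL : 32 * h ^ 2 <= L.
Hypothesis smX : smooth K L N0 Y X.
Hypothesis Y_tight : tight (8 * h * N0) (16 * h) Y.

Lemma leL32 : 32 <= L.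
Proof. by apply: leq_trans leL; rewrite leq_pmulr // expn_gt0 h_gt0. Qed.

Lemma smooth_neq i j x w : i < K -> j < K -> i != j -> x \in X i -> w \in X j -> x != w.
Proof.
have [_ dX _] := smX; move=> iK jK ij Xx Xw.
apply: contraTneq (dX i j iK jK ij) => xw.
by rewrite -setI_eq0; apply/set0Pn; exists x; rewrite inE Xx xw.
Qed.

Lemma smooth_bad32 i j x : i < K -> j < K -> i != j -> x \in X i ->
  32 * #|bad i j (X j) x| <= #|X j|.
Proof.
have [_ _ bX] := smX; move=> iK jK ij Xx; apply: leq_trans (bX i j x iK jK ij Xx).
by rewrite leq_mul2r leL32 orbT.
Qed.

(** Both sets are linear, so by tightness each has [tr] above half of [tr Y]; with forward arcs
    only, the two would add up to more than [tr Y]. *)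
Lemma backward_edge i j (A B : {set T}) : i < K -> j < K ->
  A \subset X i -> B \subset X j -> i < j ->
  #|X i| <= 4 * #|A| -> #|X j| <= 4 * #|B| ->
  exists x w, [/\ x \in A, w \in B & tarc w x].
Proof.
have [lX dX _] := smX; move=> iK jK sA sB ij leA leB.
case: (boolP [exists x in A, exists w in B, tarc w x]).
  by case/exists_inP=> x Ax /exists_inP[w Bw wx]; exists x, w.
rewrite negb_exists_in => /forall_inP no.
have big l (E : {set T}) : l < K -> E \subset X l -> #|X l| <= 4 * #|E| ->
    E \subset Y /\ 16 * h * tr Y < 16 * h * tr E + tr Y.
  move=> lK sE leE; have [sXY leX] := lX l lK.
  have sEY := subset_trans sE sXY; split=> //; apply: Y_tight => //.
  apply: leq_trans leX (leq_trans (leq_mul (leqnn N0) leE) _).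
  have -> : N0 * (4 * #|E|) = 4 * (N0 * #|E|) by ring.
  have -> : 8 * h * N0 * #|E| = (8 * h) * (N0 * #|E|) by ring.
  by rewrite leq_mul2r; move: h_gt0; lia.
have [sAY ltA] := big i A iK sA leA; have [sBY ltB] := big j B jK sB leB.
have fAB : fwd A B.
  apply/fwdP=> x w Ax Bw; have := no x Ax; rewrite negb_exists_in.
  move=> /forall_inP/(_ w Bw); have ij' : i != j by rewrite ltn_eqF.
  have := smooth_neq iK jK ij' (subsetP sA _ Ax) (subsetP sB _ Bw).
  by move=> xw; rewrite (arcC xw) negbK.
have := leq_mul (leqnn h) (tr_fwd fAB sAY sBY).
by have := leq_mul h_gt0 (leqnn (tr Y)); lia.
Qed.

Lemma quarter_left n m o b1 b2 : 2 * o <= n -> 32 * b1 <= n -> 32 * b2 <= n ->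
  n <= m + (o + (b1 + b2)) -> n <= 4 * m.
Proof. lia. Qed.

(* If a backward arc joined out-neighbours of z in X (c u) and X (c v), then a
   backward arc from X (c v).-1 to X (c u).-1 would complete it to a copy of five. *)
Lemma tr_outN_chain n (c : nat -> nat) b (U : {set T}) z :
  b <= K -> (forall u, u < n -> odd (c u) && (c u < b)) ->
  (forall u v, u < v < n -> c u < c v) -> (forall i, i < b -> X i \subset U) ->
  good U z -> (forall i, i < b -> 2 * #|outN (X i) z| <= #|X i|) ->
  \sum_(u < n) tr (outN (X (c u)) z) <= tr (outN U z).
Proof.
move=> bK cP c_incr XU /andP[nUz no5] sparse.
have /fin_all_exists[W WP] := @tr_witness T.
pose S u := W (outN (X (c u)) z).
have SP u : [/\ S u \subset outN (X (c u)) z, trans_set (S u) &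
    #|S u| = tr (outN (X (c u)) z)] by apply: WP.
move: S SP => S SP {W WP}.
have -> : \sum_(u < n) tr (outN (X (c u)) z) = \sum_(u < n) #|S u|.
  by apply: eq_bigr => u _; have [_ _ ->] := SP u.
have sXN i : i < b -> outN (X i) z \subset outN U z.
  move=> /XU sX; apply/subsetP=> w; rewrite !inE => /andP[Xw ->].
  by rewrite (subsetP sX).
apply: tr_chain => [u un|u v /andP[uv vn]].
  have /andP[_ cub] := cP u un; have [sS trS _] := SP u; split=> //.
  exact: subset_trans sS (sXN _ cub).
have /andP[oi ib] := cP u (ltn_trans uv vn); have /andP[oj jb] := cP v vn.
have ij : c u < c v by apply: c_incr; rewrite uv.
have [/subsetP sSi _ _] := SP u; have [/subsetP sSj _ _] := SP v.
move: (c u) (c v) oi ib oj jb ij sSi sSj => i j oi ib oj jb ij sSi sSj.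
apply/fwdP=> b0 a /sSi; rewrite inE => /andP[/= Xb zb] /sSj; rewrite inE => /andP[/= Xa za].
have iK := leq_trans ib bK; have jK := leq_trans jb bK.
have ba : b0 != a by apply: smooth_neq Xb Xa; rewrite // ltn_eqF.
apply: contraT; rewrite -(arcC ba) => ab.
have [i0 j0] : 0 < i /\ 0 < j by move: oi oj; case: (i) (j) => [|?] [|?].
(* Odd indices are used so that [X i.-1], [X i], [X j.-1], [X j] are distinct and occur in this
   order. *)
have ij1 : i < j.-1.
  rewrite -ltnS prednK // ltn_neqAle ij andbT; apply/eqP=> e.
  by move: oj; rewrite -e /= oi.
have i1K : i.-1 < K by apply: leq_ltn_trans (leq_pred _) iK.
have j1K : j.-1 < K by apply: leq_ltn_trans (leq_pred _) jK.
have i1b : i.-1 < b by apply: leq_ltn_trans (leq_pred _) ib.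
have j1b : j.-1 < b by apply: leq_ltn_trans (leq_pred _) jb.
have i1i : i.-1 < i by rewrite prednK.
have j1j : j.-1 < j by rewrite prednK.
have i1j : i.-1 < j by apply: ltn_trans ij.
(* [A] contains the candidates for [q] and [B] those for [p]. Excluded are out-neighbours of [z], at
   most a half, and vertices on a backward arc with [a] or [b0], at most [2/32]. *)
pose A := [set x in X i.-1 | [&& ~~ tarc z x, tarc x a & tarc x b0]].
pose B := [set x in X j.-1 | [&& ~~ tarc z x, tarc x a & tarc b0 x]].
have sA : A \subset X i.-1 by apply/subsetP=> x; rewrite inE => /andP[].
have sB : B \subset X j.-1 by apply/subsetP=> x; rewrite inE => /andP[].
have neU x l : l < b -> x \in X l -> x != z.
  by move=> lb Xx; apply: contraNneq nUz => <-; apply: subsetP (XU l lb) _ Xx.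
have leA : #|X i.-1| <= 4 * #|A|.
  have : #|X i.-1| <= #|A| + (#|outN (X i.-1) z| +
      (#|bad j i.-1 (X i.-1) a| + #|bad i i.-1 (X i.-1) b0|)).
    apply: leq_trans (leq_cardD (_ : _ \subset A :|: (outN (X i.-1) z :|:
       (bad j i.-1 (X i.-1) a :|: bad i i.-1 (X i.-1) b0)))) _.
      apply/subsetP=> x Xx; rewrite !inE Xx /wrong !(ltnNge _ i.-1) !(ltnW i1j) !(ltnW i1i) /=.
      have xa : x != a by apply: smooth_neq Xx Xa; rewrite // ltn_eqF.
      have xb : x != b0 by apply: smooth_neq Xx Xb; rewrite // ltn_eqF.
      rewrite (arcC xa) (arcC xb).
      by case: (tarc z x); case: (tarc x a); case: (tarc x b0).
    rewrite leq_add2l; apply: leq_trans (leq_cardD (subxx _)) _.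
    by rewrite leq_add2l leq_cardD.
  apply: quarter_left (sparse _ i1b) _ _.
    exact: smooth_bad32 jK i1K (negbT (gtn_eqF i1j)) Xa.
  exact: smooth_bad32 iK i1K (negbT (gtn_eqF i1i)) Xb.
have leB : #|X j.-1| <= 4 * #|B|.
  have : #|X j.-1| <= #|B| + (#|outN (X j.-1) z| +
      (#|bad j j.-1 (X j.-1) a| + #|bad i j.-1 (X j.-1) b0|)).
    apply: leq_trans (leq_cardD (_ : _ \subset B :|: (outN (X j.-1) z :|:
       (bad j j.-1 (X j.-1) a :|: bad i j.-1 (X j.-1) b0)))) _.
      apply/subsetP=> x Xx; rewrite !inE Xx /wrong ij1 (ltnNge j) (ltnW j1j) /=.
      have xa : x != a by apply: smooth_neq Xx Xa; rewrite // ltn_eqF.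
      have xb : x != b0 by apply: smooth_neq Xx Xb; rewrite // gtn_eqF.
      rewrite (arcC xa) (arcC xb).
      by case: (tarc z x); case: (tarc x a); case: (tarc x b0).
    rewrite leq_add2l; apply: leq_trans (leq_cardD (subxx _)) _.
    by rewrite leq_add2l leq_cardD.
  apply: quarter_left (sparse _ j1b) _ _.
    exact: smooth_bad32 jK j1K (negbT (gtn_eqF j1j)) Xa.
  exact: smooth_bad32 iK j1K (negbT (ltn_eqF ij1)) Xb.
have [q [p [Aq Bp pq]]] := backward_edge i1K j1K sA sB (ltn_trans i1i ij1) leA leB.
move: Aq Bp; rewrite !inE => /and4P[Xq nzq qa qb] /and4P[Xp nzp pa bp].
case/negP: no5.
apply/exists_inP; exists p; first exact: subsetP (XU _ j1b) _ Xp.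
apply/exists_inP; exists q; first exact: subsetP (XU _ i1b) _ Xq.
apply/exists_inP; exists a; first exact: subsetP (XU _ jb) _ Xa.
apply/exists_inP; exists b0; first exact: subsetP (XU _ ib) _ Xb.
rewrite /five pq pa bp qa qb ab za zb !andbT /=.
have zp : z != p by rewrite eq_sym (neU p _ j1b Xp).
have zq : z != q by rewrite eq_sym (neU q _ i1b Xq).
by rewrite (arcC zp) (arcC zq) nzp nzq.
Qed.

End Chain.

(** * Goodness of a vertex for the sets far to its left *)

Record alpha_plan (Q : tournament) (D : {set Q}) (slot run pos : Q -> nat)
    (ctr : Q -> Q) (h g : nat) (h1 h2 h3 h4 h6 : Q) : Prop := AlphaPlan {
  alpha_star : star_plan D slot run pos ctr h;
  alpha_D0 : D != set0;
  alpha_cover : forall v, v \notin D -> v \in [:: h1; h2; h3; h4; h6];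
  alpha_notin : forall v, v \in [:: h1; h2; h3; h4; h6] -> v \notin D;
  alpha_five : five h1 h2 h3 h4 h6;
  alpha_before : forall u v, u \in [:: h1; h2; h3; h4] -> v \in D -> tarc u v;
  alpha_sep : forall v, v \in D -> slot v != slot h6 /\ tarc h6 v = (slot h6 < slot v);
  alpha_slot : forall v, slot v < g }.

Section AlphaGood.
Variables (Q : tournament) (D : {set Q}) (slot run pos : Q -> nat) (ctr : Q -> Q).
Variables (h g : nat) (h1 h2 h3 h4 h6 : Q).
Hypothesis plan : alpha_plan D slot run pos ctr h g h1 h2 h3 h4 h6.
Variables (T : tournament) (K L N0 : nat) (Y : {set T}) (X : nat -> {set T}).
Hypothesis leL : 32 * h ^ 2 <= L.
Hypothesis smX : smooth K L N0 Y X.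
Hypothesis Y_tight : tight (8 * h * N0) (16 * h) Y.
Hypothesis Y_big : 16 * h <= tr Y.
Hypothesis nQ : ~ contains T Q.

Lemma alpha_good k b z : z \in X k -> b + g <= k -> k + g <= K ->
  good (\bigcup_(i < b) X i) z.
Proof.
move=> Xz bk kK; have h_gt0 := plan_h_gt0 (alpha_star plan) (alpha_D0 plan).
have slotg v := alpha_slot plan v.
have kltK : k < K by have := slotg h6; lia.
have neq := smooth_neq smX; have bad32 := smooth_bad32 h_gt0 leL smX.
have bK (i : 'I_b) : i < K by have := ltn_ord i; lia.
apply/andP; split.
  apply/bigcupP=> [[i _ Xiz]]; have := neq i k z z (bK i) kltK.
  by rewrite ltn_eqF ?eqxx => [/(_ isT Xiz Xz)|] //; have := ltn_ord i; lia.
apply/negP=> /exists_inP[p /bigcupP[ip _ Xp] /exists_inP[q /bigcupP[iq _ Xq]]].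
move=> /exists_inP[a /bigcupP[ia _ Xa] /exists_inP[b0 /bigcupP[ib _ Xb] f5]].
(* The slots are shifted so that [h6], embedded as [z], falls on [k]. As slots are below [g], all
   shifted ones lie between [b] and [K]. *)
pose idx s := k + s - slot h6.
pose C s := [set w in X (idx s) | [&& tarc p w, tarc q w, tarc a w, tarc b0 w &
   if slot h6 < s then tarc z w else tarc w z]].
have idxK v : idx (slot v) < K by rewrite /idx; have := slotg v; have := slotg h6; lia.
have idxb v (i : 'I_b) : i < idx (slot v).
  by rewrite /idx; have := slotg h6; have := ltn_ord i; lia.
have idx_eq s t : slot h6 <= k + s -> slot h6 <= k + t -> (idx s == idx t) = (s == t).
  by rewrite /idx; lia.
have h6k s : slot h6 <= k + s by have := slotg h6; lia.
have idxz v : v \in D -> idx (slot v) != k.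
  move=> /(alpha_sep plan)[sv _]; have := idx_eq (slot v) (slot h6) (h6k _) (h6k _).
  by rewrite {2}/idx addnK => ->.
have idx_lt s t : (idx s < idx t) = (s < t).
  by rewrite /idx; have := h6k s; have := h6k t; lia.
(* Each of the five vertices already placed excludes at most [1/32] of the set. *)
have C_big v : v \in D -> 3 * #|X (idx (slot v))| <= 4 * #|C (slot v)|.
  move=> Dv; set j := idx _; have jK : j < K := idxK v.
  have bi x (i : 'I_b) : x \in X i -> 32 * #|bad i j (X j) x| <= #|X j|.
    by move=> Xx; apply: bad32 => //; rewrite ltn_eqF // idxb.
  have kj : k != j by rewrite eq_sym idxz.
  have := bad32 k j z kltK jK kj Xz.
  have := bi p ip Xp; have := bi q iq Xq; have := bi a ia Xa; have := bi b0 ib Xb.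
  suff : #|X j| <= #|C (slot v)| + (#|bad ip j (X j) p| + (#|bad iq j (X j) q| +
     (#|bad ia j (X j) a| + (#|bad ib j (X j) b0| + #|bad k j (X j) z|)))) by lia.
  apply: leq_trans (leq_cardD (_ : _ \subset C (slot v) :|: (bad ip j (X j) p :|:
     (bad iq j (X j) q :|: (bad ia j (X j) a :|: (bad ib j (X j) b0 :|: bad k j (X j) z)))))) _.
    apply/subsetP=> w Xw; rewrite !inE Xw /wrong !idxb /=.
    have ne x (i : 'I_b) : x \in X i -> x != w.
      by move=> Xx; apply: neq Xx Xw; rewrite // ltn_eqF // idxb.
    have zw : z != w by apply: neq Xz Xw.
    rewrite (arcC (ne p ip Xp)) (arcC (ne q iq Xq)) (arcC (ne a ia Xa)) (arcC (ne b0 ib Xb)).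
    have -> : (k < j) = (slot h6 < slot v).
      by rewrite -(idx_lt (slot h6) (slot v)) [idx (slot h6)]addnK.
    rewrite (arcC zw); case: (slot h6 < slot v);
    by case: (tarc p w); case: (tarc q w); case: (tarc a w); case: (tarc b0 w); case: (tarc z w).
  by do 3!(rewrite leq_add2l; apply: leq_trans (leq_cardD (subxx _)) _); rewrite leq_add2l leq_cardD.
have [lX dX bX] := smX.
have subC : {in D, forall v, C (slot v) \subset X (idx (slot v)) /\
    3 * #|X (idx (slot v))| <= 4 * #|C (slot v)|}.
  by move=> v Dv; split; [apply/subsetP=> w; rewrite inE => /andP[] | apply: C_big].
have linX : {in D, forall v, X (idx (slot v)) \subset Y /\
    #|Y| <= N0 * #|X (idx (slot v))|} by move=> v _; apply: lX.
have disX : {in D &, forall u v, slot u != slot v ->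
    [disjoint X (idx (slot u)) & X (idx (slot v))]}.
  by move=> u v _ _ suv; apply: dX => //; rewrite idx_eq.
have badX : {in D &, forall u v x, slot u != slot v -> x \in X (idx (slot u)) ->
    L * #|bad (slot u) (slot v) (X (idx (slot v))) x| <= #|X (idx (slot v))|}.
  move=> u v _ _ x suv Xx; have := bX (idx (slot u)) (idx (slot v)) x (idxK u) (idxK v).
  by rewrite idx_eq // /bad /wrong idx_lt => /(_ suv Xx).
have [f [f1 f2]] := @star_embedding Q D slot run pos ctr h L N0 T Y
    (fun s => X (idx s)) C (alpha_star plan) leL subC linX disX badX Y_tight Y_big
    (alpha_D0 plan) z.
apply: nQ.
pose F v := if v \in D then f v else if v == h1 then p else if v == h2 then q else
  if v == h3 then a else if v == h4 then b0 else z.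
have := alpha_five plan => /and5P[e12 e13 e41 e16 /and5P[e23 e24 e26 e34 /andP[e63 e64]]].
have := f5 => /and5P[g12 g13 g41 g16 /and5P[g23 g24 g26 g34 /andP[g63 g64]]].
have nD v : v \in [:: h1; h2; h3; h4; h6] -> (v \in D) = false.
  by move=> /(alpha_notin plan)/negbTE.
have F1 : F h1 = p by rewrite /F nD ?mem_head // eqxx.
have F2 : F h2 = q.
  by rewrite /F nD ?inE ?eqxx ?orbT // eq_sym (negbTE (arc_neq e12)).
have F3 : F h3 = a.
  rewrite /F nD ?inE ?eqxx ?orbT // eq_sym (negbTE (arc_neq e13)).
  by rewrite eq_sym (negbTE (arc_neq e23)).
have F4 : F h4 = b0.
  rewrite /F nD ?inE ?eqxx ?orbT // (negbTE (arc_neq e41)).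
  by rewrite eq_sym (negbTE (arc_neq e24)) eq_sym (negbTE (arc_neq e34)).
have F6 : F h6 = z.
  rewrite /F nD ?inE ?eqxx ?orbT // eq_sym (negbTE (arc_neq e16)).
  by rewrite eq_sym (negbTE (arc_neq e26)) (negbTE (arc_neq e63)) (negbTE (arc_neq e64)).
have FD v : v \in D -> F v = f v by rewrite /F => ->.
have ag u v : tarc u v -> tarc (F u) (F v) -> agrees u v (F u) (F v) /\ agrees v u (F v) (F u).
  by move=> uv Fuv; rewrite /agrees uv (negbTE (arc_asym uv)).
have sq u v : u \in [:: h1; h2; h3; h4; h6] -> v \in D -> agrees u v (F u) (F v).
  move=> hu Dv; have := f1 v Dv; rewrite (FD v Dv) inE => /and5P[_ pw qw aw /andP[bw zw]].
  have bef x : x \in [:: h1; h2; h3; h4] -> tarc x v.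
    by move=> hx; apply: (alpha_before plan).
  move: hu; rewrite !inE => /or4P[/eqP->|/eqP->|/eqP->|/orP[/eqP->|/eqP->]].
  - by rewrite F1 /agrees bef ?inE ?eqxx ?orbT.
  - by rewrite F2 /agrees bef ?inE ?eqxx ?orbT.
  - by rewrite F3 /agrees bef ?inE ?eqxx ?orbT.
  - by rewrite F4 /agrees bef ?inE ?eqxx ?orbT.
  - by rewrite F6 /agrees; have [_ ->] := alpha_sep plan Dv.
apply: (@contains_of_mono _ _ F) => u v uv.
suff /(agreesE uv)[] : agrees u v (F u) (F v) by [].
case: (boolP (u \in D)) => Du; case: (boolP (v \in D)) => Dv.
- by rewrite !FD //; apply: f2.
- by rewrite agreesC //; apply: sq => //; apply: (alpha_cover plan).
- by apply: sq => //; apply: (alpha_cover plan).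
have [a12 a21] : agrees h1 h2 (F h1) (F h2) /\ agrees h2 h1 (F h2) (F h1) by apply: ag; rewrite ?F1 ?F2.
have [a13 a31] : agrees h1 h3 (F h1) (F h3) /\ agrees h3 h1 (F h3) (F h1) by apply: ag; rewrite ?F1 ?F3.
have [a41 a14] : agrees h4 h1 (F h4) (F h1) /\ agrees h1 h4 (F h1) (F h4) by apply: ag; rewrite ?F1 ?F4.
have [a16 a61] : agrees h1 h6 (F h1) (F h6) /\ agrees h6 h1 (F h6) (F h1) by apply: ag; rewrite ?F1 ?F6.
have [a23 a32] : agrees h2 h3 (F h2) (F h3) /\ agrees h3 h2 (F h3) (F h2) by apply: ag; rewrite ?F2 ?F3.
have [a24 a42] : agrees h2 h4 (F h2) (F h4) /\ agrees h4 h2 (F h4) (F h2) by apply: ag; rewrite ?F2 ?F4.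
have [a26 a62] : agrees h2 h6 (F h2) (F h6) /\ agrees h6 h2 (F h6) (F h2) by apply: ag; rewrite ?F2 ?F6.
have [a34 a43] : agrees h3 h4 (F h3) (F h4) /\ agrees h4 h3 (F h4) (F h3) by apply: ag; rewrite ?F3 ?F4.
have [a63 a36] : agrees h6 h3 (F h6) (F h3) /\ agrees h3 h6 (F h3) (F h6) by apply: ag; rewrite ?F6 ?F3.
have [a64 a46] : agrees h6 h4 (F h6) (F h4) /\ agrees h4 h6 (F h4) (F h6) by apply: ag; rewrite ?F6 ?F4.
move: (alpha_cover plan Du) (alpha_cover plan Dv) uv; rewrite !inE.
case/or4P=> [/eqP->|/eqP->|/eqP->|/orP[/eqP->|/eqP->]];
  by case/or4P=> [/eqP->|/eqP->|/eqP->|/orP[/eqP->|/eqP->]]; rewrite ?eqxx.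
Qed.

End AlphaGood.

Import Order.TTheory GRing.Theory Num.Theory.

(** * Balanced sets and the two ways of combining blocks *)

Section Claim.
Variables (R : realFieldType) (T : tournament) (phi : nat -> R).
Implicit Types (Y Z S : {set T}) (z w : T) (B : R) (mu : T -> R).
Local Open Scope ring_scope.

Definition conf z S := [exists w in S, tarc z w].

(* By LP duality, a probability distribution on the transitive subsets S of Y
   such that B times the expected size of S is at least phi #|Y| / tr Y and each
   good z has an out-neighbour in S with probability at most tr (outN Y z) / B. *)
Definition balanced Y B :=
  0 < B <= (tr Y)%:R /\
  forall mu, (forall z, 0 <= mu z) -> (forall z, ~~ good Y z -> mu z = 0) ->
  exists S, [/\ S \subset Y, trans_set S &
    phi #|Y| / (tr Y)%:R - \sum_z mu z * (tr (outN Y z))%:R <=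
    B * (#|S|%:R - \sum_z mu z * (conf z S)%:R)].

(** For [mu = 0] the inequality reads [phi #|Y| / tr Y <= B * #|S|], and both factors on the right
    are at most [tr Y]. *)
Lemma balanced_large Y B : balanced Y B -> phi #|Y| <= ((tr Y) ^ 3)%:R.
Proof.
case=> /andP[B0 leB] /(_ (fun _ => 0)) [//|//|S [sSY trS]].
rewrite !big1 ?subr0 => [leS|? _|? _]; rewrite ?mul0r //.
have t0 : 0 < (tr Y)%:R :> R by apply: lt_le_trans leB.
have leSt : #|S|%:R <= (tr Y)%:R :> R by rewrite ler_nat leq_tr.
rewrite ler_pdivrMr // in leS; apply: le_trans leS _.
by rewrite natrX exprS expr2 mulrA ler_pM2r // ler_pM // ltW.
Qed.

Lemma conf_outN Y S z : S \subset Y -> conf z S -> (0 < tr (outN Y z))%N.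
Proof.
move=> /subsetP sSY /exists_inP[w Sw zw]; rewrite tr_gt0; apply/card_gt0P.
by exists w; rewrite inE sSY.
Qed.

(** A single vertex suffices: whoever attacks it has an out-neighbourhood in [Y] with [tr] at least
    1. *)
Lemma balanced_base Y : (0 < #|Y|)%N -> phi #|Y| <= (tr Y)%:R -> balanced Y 1.
Proof.
move=> Y0 lephi; have t0 : (0 < tr Y)%N by rewrite tr_gt0.
split; first by rewrite ltr01 ler1n.
move=> mu mu0 _; have [w Yw] := card_gt0P Y0.
exists [set w]; rewrite sub1set Yw trans_set1 cards1 mul1r; split=> //.
apply: lerB; first by rewrite ler_pdivrMr ?ltr0n // mul1r.
apply: ler_sum => z _; rewrite ler_wpM2l // ler_nat.
case: (boolP (conf z _)) => // /(@conf_outN Y); rewrite sub1set; exact.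
Qed.

(** The same weights serve for [Z]: a vertex good for [Y] is good for [Z], and its out-neighbourhood
    only shrinks. *)
Lemma balanced_sub Y Z B : Z \subset Y -> balanced Z B ->
  phi #|Y| / (tr Y)%:R <= phi #|Z| / (tr Z)%:R -> balanced Y B.
Proof.
move=> sZY [/andP[B0 leB] bal] lephi; split.
  by rewrite B0 (le_trans leB) // ler_nat trS.
move=> mu mu0 mug; have [|S [sSZ trS_ leS]] := bal mu mu0.
  by move=> z nz; apply: mug; apply: contra nz; apply: goodS.
exists S; split=> //; first exact: subset_trans sSZ sZY.
apply: le_trans leS; apply: lerB => //; apply: ler_sum => z _.
rewrite ler_wpM2l // ler_nat trS //; apply/subsetP=> w; rewrite !inE.
by case/andP=> /(subsetP sZY)-> ->.
Qed.

(** Dual form of drawing [u] with probability proportional to [B u]: the weighted average of the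
    gains is at most the best gain. *)
Lemma balanced_block n (Yc : 'I_n.+1 -> {set T}) (B : 'I_n.+1 -> R) E mu :
  (forall u, balanced (Yc u) (B u)) ->
  (forall u, E <= phi #|Yc u| / (tr (Yc u))%:R) ->
  (forall z, 0 <= mu z) -> (forall u z, ~~ good (Yc u) z -> mu z = 0) ->
  exists u S, [/\ S \subset Yc u, trans_set S &
    n.+1%:R * E - \sum_z mu z * (\sum_u tr (outN (Yc u) z))%:R <=
    (\sum_u B u) * (#|S|%:R - \sum_z mu z * (conf z S)%:R)].
Proof.
move=> bal leE mu0 mug.
have /fin_all_exists[S SP] : forall u, exists S, [/\ S \subset Yc u, trans_set S &
    phi #|Yc u| / (tr (Yc u))%:R - \sum_z mu z * (tr (outN (Yc u) z))%:R <=
    B u * (#|S|%:R - \sum_z mu z * (conf z S)%:R)].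
  by move=> u; have [_ balu] := bal u; apply: balu => // z; apply: mug.
pose val u := #|S u|%:R - \sum_z mu z * (conf z (S u))%:R : R.
have [u0 _ max_u0] := @Order.TotalTheory.arg_maxP _ _ _ ord0 xpredT val isT.
have [sS trS_ _] := SP u0; exists u0, (S u0); split=> //.
rewrite -/(val u0) mulr_suml.
apply: le_trans (_ : \sum_u B u * val u <= _); last first.
  apply: ler_sum => u _; have [/andP[/ltW B0 _] _] := bal u.
  by rewrite ler_wpM2l //; apply: max_u0.
apply: le_trans (_ : \sum_u (E - \sum_z mu z * (tr (outN (Yc u) z))%:R) <= _).
  rewrite sumrB sumr_const card_ord -[E *+ _]mulr_natl lerB // exchange_big /=.
  by apply: ler_sum => z _; rewrite -mulr_sumr natr_sum.
apply: ler_sum => u _; have [_ _ leu] := SP u; apply: le_trans leu.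
by rewrite lerB.
Qed.

Definition restrict (d : pred T) mu z := if d z then 0 else mu z.

Lemma restrict_ge0 d mu : (forall z, 0 <= mu z) -> forall z, 0 <= restrict d mu z.
Proof. by move=> mu0 z; rewrite /restrict; case: ifP. Qed.

Section Step.
Variables (Y : {set T}) (E : R) (dense : pred T).
Hypothesis Y_gt0 : (0 < #|Y|)%N.
Hypothesis E_ge0 : 0 <= E.
Hypothesis leE : phi #|Y| / (tr Y)%:R <= 16 / 15 * E.
Hypothesis dense_large : forall z, dense z -> (2 * tr Y <= 3 * tr (outN Y z))%N.
Let t : R := (tr Y)%:R.
Let mass mu := \sum_z mu z * (tr (outN Y z))%:R.

Lemma t_gt0 : 0 < t.
Proof. by rewrite ltr0n tr_gt0. Qed.

Lemma mass_ge0 mu : (forall z, 0 <= mu z) -> 0 <= mass mu.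
Proof. by move=> mu0; apply: sumr_ge0 => z _; rewrite mulr_ge0. Qed.

(** A dense [z] satisfies [B * conf z S <= B <= tr (outN Y z)], so its weight can be ignored. *)
Lemma dense_free mu S B : (forall z, 0 <= mu z) -> 0 <= B -> 3 * B <= 2 * t ->
  16 / 15 * E - mass (restrict dense mu) <=
    B * (#|S|%:R - \sum_z restrict dense mu z * (conf z S)%:R) ->
  phi #|Y| / (tr Y)%:R - mass mu <= B * (#|S|%:R - \sum_z mu z * (conf z S)%:R).
Proof.
move=> mu0 B0 leB le1; set nu := restrict dense mu in le1 *.
have : B * (\sum_z mu z * (conf z S)%:R) - mass mu <=
    B * (\sum_z nu z * (conf z S)%:R) - mass nu.
  rewrite !mulr_sumr -!sumrB; apply: ler_sum => z _.
  rewrite /nu /restrict; case: ifP => // dz.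
  rewrite !mul0r mulr0 subr0 mulrCA -mulrBr mulr_ge0_le0 // subr_le0.
  have : (2 * tr Y)%:R <= (3 * tr (outN Y z))%:R :> R by rewrite ler_nat dense_large.
  by rewrite !natrM -/t; case: (conf z S); rewrite ?mulr1 ?mulr0; lra.
by rewrite !mulrBr in le1 *; move: leE le1; lra.
Qed.

Section Mix.
Variables (Yc : 'I_40 -> {set T}) (B : 'I_40 -> R).
Hypothesis Yc_sub : forall u, Yc u \subset Y.
Hypothesis Yc_bal : forall u, balanced (Yc u) (B u).
Hypothesis Yc_E : forall u, E <= phi #|Yc u| / (tr (Yc u))%:R.
Hypothesis Yc_chain : forall z, good Y z -> ~~ dense z ->
  (\sum_u tr (outN (Yc u) z) <= tr (outN Y z))%N.

Lemma block_gt0 : 0 < \sum_u B u.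
Proof.
rewrite (bigD1 ord0) //=; have [/andP[B0 _] _] := Yc_bal ord0.
apply: ltr_pwDl => //; apply: sumr_ge0 => u _.
by have [/andP[/ltW]] := Yc_bal u.
Qed.

Lemma block_le : \sum_u B u <= 40 * t.
Proof.
rewrite -[40]/(40%:R) -[X in X%:R * _](card_ord 40) mulr_natl -sumr_const.
apply: ler_sum => u _; have [/andP[_ leB] _] := Yc_bal u.
by apply: le_trans leB _; rewrite ler_nat trS.
Qed.

Lemma restrict_good mu : (forall z, ~~ good Y z -> mu z = 0) ->
  forall u z, ~~ good (Yc u) z -> restrict dense mu z = 0.
Proof.
move=> mug u z nz; rewrite /restrict; case: ifP => // _; apply: mug.
by apply: contra nz; apply: goodS.
Qed.

Lemma block_mass mu : (forall z, 0 <= mu z) -> (forall z, ~~ good Y z -> mu z = 0) ->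
  \sum_z restrict dense mu z * (\sum_u tr (outN (Yc u) z))%:R <=
  mass (restrict dense mu).
Proof.
move=> mu0 mug; apply: ler_sum => z _; rewrite /restrict; case: ifP => dz.
  by rewrite !mul0r.
case: (boolP (good Y z)) => gz; last by rewrite mug // !mul0r.
by rewrite ler_wpM2l // ler_nat Yc_chain // dz.
Qed.

(** [B'] is the smaller of [\sum_u B u] and [2/3 t]. In the second case the block inequality is
    scaled by some [r] with [1/15 <= r <= 1], and [40/15] is still above [16/15]. *)
Lemma balanced_mix : \sum_u B u <= 10 * t -> exists B', balanced Y B'.
Proof.
move=> leBS; have BS0 := block_gt0; have t0 := t_gt0; set BS := \sum_u B u in leBS BS0 *.
have step mu : (forall z, 0 <= mu z) -> (forall z, ~~ good Y z -> mu z = 0) ->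
    exists S, [/\ S \subset Y, trans_set S & 40 * E - mass (restrict dense mu) <=
      BS * (#|S|%:R - \sum_z restrict dense mu z * (conf z S)%:R)].
  move=> mu0 mug.
  have [u [S [sS trS_ leS]]] := balanced_block Yc_bal Yc_E (restrict_ge0 dense mu0)
    (restrict_good mug).
  exists S; split=> //; first exact: subset_trans sS (Yc_sub u).
  by apply: le_trans leS; rewrite lerB // block_mass.
have [le1|lt1] := lerP BS (2 / 3 * t).
  exists BS; split; first by rewrite BS0 -/t; lra.
  move=> mu mu0 mug; have [S [sS trS_ leS]] := step mu mu0 mug; exists S; split=> //.
  apply: dense_free => //; [exact: ltW | by lra | by move: leS E_ge0; lra].
exists (2 / 3 * t); split; first by apply/andP; rewrite -/t; split; lra.
move=> mu mu0 mug; have [S [sS trS_ leS]] := step mu mu0 mug; exists S; split=> //.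
apply: dense_free => //; [by lra | by lra |].
set M := mass _ in leS *; set val := (X in _ <= _ * X).
have M0 : 0 <= M by apply: mass_ge0; apply: restrict_ge0.
pose r := 2 / 3 * t / BS.
have rBS : r * BS = 2 / 3 * t by rewrite /r divfK // gt_eqF.
have r1 : r <= 1 by rewrite /r ler_pdivrMr // mul1r ltW.
have r2 : 1 / 15 <= r by rewrite /r ler_pdivlMr //; lra.
rewrite -rBS -[X in _ <= X]mulrA.
have : r * (40 * E - M) <= r * (BS * val) by rewrite ler_wpM2l //; lra.
move=> le_r; apply: le_trans _ le_r.
have h1 : 0 <= (1 - r) * M by rewrite mulr_ge0 // subr_ge0.
have h2 : 0 <= (r - 1 / 15) * E by rewrite mulr_ge0 // subr_ge0.
by move: E_ge0; lra.
Qed.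

End Mix.

(** The scaling factor [t / s] is at least [1/40], which serves for [E], and at most [1/10], which
    serves for [x]. *)
Lemma scaled_block (s x y : R) : 10 * t <= s -> s <= 40 * t -> 0 <= x ->
  40 * E - x <= s * y -> E - x / 10 <= t * y.
Proof.
move=> les ges x0 ley; have t0 := t_gt0; have s0 : 0 < s by lra.
pose r := t / s; have rs : r * s = t by rewrite /r divfK // gt_eqF.
have r1 : r <= 1 / 10 by rewrite /r ler_pdivrMr //; lra.
have r2 : 1 / 40 <= r by rewrite /r ler_pdivlMr //; lra.
rewrite -rs -[X in _ <= X]mulrA; have : r * (40 * E - x) <= r * (s * y) by rewrite ler_wpM2l //; lra.
move=> le_r; apply: le_trans _ le_r.
have h1 : 0 <= (1 / 10 - r) * x by rewrite mulr_ge0 // subr_ge0.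
have h2 : 0 <= (r - 1 / 40) * E by rewrite mulr_ge0 // subr_ge0.
by lra.
Qed.

(* The right block is treated first; the resulting set S' is then added to the
   weights of the left block, so that few vertices of S' have to be deleted. *)
Lemma balanced_merge (Yl Yr : 'I_40 -> {set T}) (Bl Br : 'I_40 -> R) :
  (forall u, Yl u \subset Y) -> (forall u, Yr u \subset Y) ->
  (forall u, balanced (Yl u) (Bl u)) -> (forall u, balanced (Yr u) (Br u)) ->
  (forall u, E <= phi #|Yl u| / (tr (Yl u))%:R) ->
  (forall u, E <= phi #|Yr u| / (tr (Yr u))%:R) ->
  (forall z, good Y z -> ~~ dense z ->
     (\sum_u tr (outN (Yl u) z) <= tr (outN Y z))%N) ->
  (forall z, good Y z -> ~~ dense z ->
     (\sum_u tr (outN (Yr u) z) <= tr (outN Y z))%N) ->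
  (forall v z, z \in Yr v -> (forall u, good (Yl u) z) /\
     (\sum_u tr (outN (Yl u) z) <= tr Y)%N) ->
  10 * t <= \sum_u Bl u -> 10 * t <= \sum_u Br u ->
  balanced Y (2 / 3 * t).
Proof.
move=> sYl sYr ball balr El Er chl chr rl gel ger; have t0 := t_gt0.
split; first by apply/andP; rewrite -/t; split; lra.
move=> mu mu0 mug; pose nu := restrict dense mu; pose M := mass nu.
have nu0 : forall z, 0 <= nu z by apply: restrict_ge0.
have M0 : 0 <= M by apply: mass_ge0.
(* A tenth of [#|S'|] will be lost to deletions; the factor makes [9/10] of the gain of [S'] equal
   to [9/10 #|S'|] minus its cost under [nu]. *)
pose nu' z := 10 / 9 * nu z.
have [||v [S' [sS' trS' leS']]] := @balanced_block _ Yr Br E nu' balr Er.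
- by move=> z; rewrite mulr_ge0 //; lra.
- by move=> u z /(restrict_good sYr mug); rewrite /nu' /nu => ->; rewrite mulr0.
have rS' z : z \in S' -> (forall u, good (Yl u) z) /\
    (\sum_u tr (outN (Yl u) z) <= tr Y)%N.
  by move=> S'z; apply: (rl v); apply: subsetP sS' _ S'z.
pose nu2 z := nu z + (z \in S')%:R.
have [||u [S [sS trS_ leS]]] := @balanced_block _ Yl Bl E nu2 ball El.
- by move=> z; rewrite addr_ge0.
- move=> w z nz; rewrite /nu2 /nu (restrict_good sYl mug nz) add0r.
  by case: (boolP (z \in S')) => // /rS'[gz _]; rewrite gz in nz.
pose F := [set z in S' | conf z S].
have dSS' z : z \in S -> z \notin S'.
  move=> Sz; apply/negP=> /rS'[/(_ u)/andP[nz _] _].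
  by rewrite (subsetP sS z Sz) in nz.
have fSS' : fwd S (S' :\: F).
  apply/fwdP=> x z Sx; rewrite !inE => /andP[nc S'z].
  rewrite S'z /= in nc; rewrite arc_neg //.
    by apply: contraTneq S'z => ->; apply: dSS'.
  by apply: contra nc => zx; apply/exists_inP; exists x.
exists (S :|: S' :\: F); split.
- rewrite subUset (subset_trans sS) //= (subset_trans (subsetDl _ _)) //.
  exact: subset_trans sS' (sYr v).
- by apply: trans_setU => //; apply: trans_setS trS'; apply: subsetDl.
apply: dense_free => //; [by lra | by lra |]; rewrite -/nu -/M.
have sFS' : F \subset S' by apply/subsetP=> z; rewrite inE => /andP[].
have -> : #|S :|: S' :\: F|%:R = #|S|%:R + #|S'|%:R - #|F|%:R :> R.
  rewrite card_fwdU // cardsD (setIidPr sFS') natrD natrB ?subset_leq_card //.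
  by rewrite addrA.
pose cost A := \sum_z nu z * (conf z A)%:R : R.
have cW : cost (S :|: S' :\: F) <= cost S + cost S'.
  rewrite /cost -big_split; apply: ler_sum => z _ /=; rewrite -mulrDr ler_wpM2l //.
  rewrite -natrD ler_nat; case: (boolP (conf z (_ :|: _))) => // /exists_inP[w].
  rewrite !inE => /orP[Sw|/andP[_ S'w]] zw.
    by have -> : conf z S by apply/exists_inP; exists w.
  have -> : conf z S' by apply/exists_inP; exists w.
  by rewrite addnC.
have cost' : \sum_z nu' z * (conf z S')%:R = 10 / 9 * cost S'.
  by rewrite mulr_sumr; apply: eq_bigr => z _; rewrite mulrA.
have cost2 : \sum_z nu2 z * (conf z S)%:R = cost S + #|F|%:R.
  rewrite /cost -sum1_card natr_sum [X in _ = _ + X]big_mkcond -big_split /=.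
  apply: eq_bigr => z _ /=.
  rewrite mulrDl inE; case: (z \in S'); case: (conf z S); rewrite ?mulr1 ?mulr0 //.
have massr : \sum_z nu' z * (\sum_u tr (outN (Yr u) z))%:R <= 10 / 9 * M.
  rewrite (_ : \sum_z _ = 10 / 9 * \sum_z nu z * (\sum_u tr (outN (Yr u) z))%:R).
    by rewrite ler_wpM2l //; [lra | apply: block_mass].
  by rewrite mulr_sumr; apply: eq_bigr => z _; rewrite mulrA.
have massl : \sum_z nu2 z * (\sum_u tr (outN (Yl u) z))%:R <= M + #|S'|%:R * t.
  rewrite -sum1_card natr_sum mulr_suml [X in _ <= _ + X]big_mkcond /=.
  apply: le_trans (lerD (block_mass chl mu0 mug) (lexx _)).
  rewrite -big_split; apply: ler_sum => z _ /=; rewrite mulrDl lerD2l.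
  case: (boolP (z \in S')) => [/rS'[_ le1]|_]; last by rewrite mul0r.
  by rewrite !mul1r ler_nat.
rewrite cost' in leS'; rewrite cost2 in leS.
have S'0 : 0 <= #|S'|%:R * t by rewrite mulr_ge0 // ltW.
have h1 := @scaled_block _ (10 / 9 * M) (#|S'|%:R - 10 / 9 * cost S') ger
  (block_le sYr balr).
have h2 := @scaled_block _ (M + #|S'|%:R * t) (#|S|%:R - (cost S + #|F|%:R)) gel
  (block_le sYl ball).
have {}h1 : E - 10 / 9 * M / 10 <= t * (#|S'|%:R - 10 / 9 * cost S').
  by apply: h1; [lra | apply: le_trans leS'; rewrite lerB].
have {}h2 : E - (M + #|S'|%:R * t) / 10 <= t * (#|S|%:R - (cost S + #|F|%:R)).
  by apply: h2; [lra | apply: le_trans leS; rewrite lerB].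
have h3 := ler_wpM2l (ltW t0) cW.
(* [h2] plus [9/10] of [h1] bounds [t] times the gain from below by [19/10 E - M / 5]; two thirds of
   this are at least [16/15 E - M]. *)
rewrite -/(cost _); move: h1 h2 h3 E_ge0; rewrite !mulrDr !mulrN; lra.
Qed.

End Step.
End Claim.

(** * Induction over the subsets of an [H]-free tournament *)

Section AllBalanced.
Variables (Q : tournament) (D : {set Q}) (slot run pos : Q -> nat) (ctr : Q -> Q).
Variables (h g : nat) (h1 h2 h3 h4 h6 : Q).
Hypothesis plan : alpha_plan D slot run pos ctr h g h1 h2 h3 h4 h6.
Variables (R : realFieldType) (T : tournament) (phi : nat -> R) (kappa : R).
Variables (L N0 n0 : nat).
Hypothesis leL : 32 * h ^ 2 <= L.
Hypothesis nQ : ~ contains T Q.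
Hypothesis structure : forall Y : {set T}, 0 < #|Y| -> n0 <= #|Y| ->
  exists X, smooth (160 * g) L N0 Y X.
Hypothesis n0_big : 2 ^ (16 * h) <= n0.
Hypothesis phi_ge0 : forall n, (0 <= phi n)%R.
Hypothesis phi1 : (phi 1 <= 1)%R.
Hypothesis phi_small : forall n, n <= n0 -> (phi n <= 2)%R.
Hypothesis phi_ratio : forall n m, n <= 8 * h * N0 * m -> (phi n <= kappa * phi m)%R.
Hypothesis kappa_le : (kappa <= 16 / 15)%R.
Hypothesis kappa_h : (kappa * ((16 * h)%:R - 1) <= (16 * h)%:R)%R.

Let h_gt0 := plan_h_gt0 (alpha_star plan) (alpha_D0 plan).

Lemma g_gt0 : 0 < g.
Proof. exact: leq_ltn_trans (leq0n _) (alpha_slot plan h1). Qed.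

(** Passing to [Z] costs at most a factor [kappa] in [phi] and gains at least [16 h / (16 h - 1)] in
    [1 / tr]; [kappa_h] says that the gain prevails. *)
Lemma balanced_loose (Y Z : {set T}) (B : R) : 0 < #|Y| -> Z \subset Y ->
  #|Y| <= 8 * h * N0 * #|Z| -> 16 * h * tr Z + tr Y <= 16 * h * tr Y ->
  balanced phi Z B -> balanced phi Y B.
Proof.
move=> Y0 sZY leYZ trZ balZ; apply: balanced_sub sZY balZ _.
have Z0 : 0 < #|Z|.
  by have := leq_trans Y0 leYZ; rewrite muln_gt0 => /andP[].
have tY : (0 < (tr Y)%:R :> R)%R by rewrite ltr0n tr_gt0.
have tZ : (0 < (tr Z)%:R :> R)%R by rewrite ltr0n tr_gt0.
have h0 : (0 < (16 * h)%:R :> R)%R by rewrite ltr0n muln_gt0 h_gt0.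
have trZ' : ((16 * h)%:R * (tr Z)%:R <= ((16 * h)%:R - 1) * (tr Y)%:R :> R)%R.
  by rewrite mulrBl mul1r lerBrDr -!natrM -natrD ler_nat.
rewrite ler_pdivrMr // mulrAC ler_pdivlMr // -(ler_pM2l h0).
have le1 := ler_wpM2l (phi_ge0 #|Y|) trZ'.
have h1' : (0 <= ((16 * h)%:R - 1) * (tr Y)%:R :> R)%R.
  by rewrite mulr_ge0 ?subr_ge0 ?ler1n ?muln_gt0 ?h_gt0 // ltW.
have le2 := ler_wpM2r h1' (phi_ratio leYZ).
have le3 : (phi #|Z| * (tr Y)%:R * (kappa * ((16 * h)%:R - 1)) <=
   phi #|Z| * (tr Y)%:R * (16 * h)%:R)%R.
  by rewrite ler_wpM2l // mulr_ge0 // ltW.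
have -> : ((16 * h)%:R * (phi #|Y| * (tr Z)%:R) =
   phi #|Y| * ((16 * h)%:R * (tr Z)%:R))%R by ring.
apply: le_trans le1 (le_trans le2 _); apply: le_trans (le_trans _ le3) _.
  by rewrite le_eqVlt; apply/orP; left; apply/eqP; ring.
by rewrite le_eqVlt; apply/orP; left; apply/eqP; ring.
Qed.

Lemma balanced_tight (Y : {set T}) : 0 < #|Y| -> n0 <= #|Y| ->
  tight (8 * h * N0) (16 * h) Y ->
  (forall Z : {set T}, 0 < #|Z| -> #|Z| < #|Y| -> exists B, balanced phi Z B) ->
  exists B, balanced phi Y B.
Proof.
move=> Y0 leY tY IH; have [X smX] := structure Y0 leY; have g0 := g_gt0.
have Y_big : 16 * h <= tr Y.
  by apply/ltnW/tr_log; apply: leq_trans n0_big leY.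
have t0 : (0 < (tr Y)%:R :> R)%R by rewrite ltr0n tr_gt0.
have [lX dX _] := smX.
have X0 i : i < 160 * g -> 0 < #|X i|.
  by move=> /lX[_ leX]; move: (leq_trans Y0 leX); rewrite muln_gt0 => /andP[].
have X_small i : i < 160 * g -> #|X i| < #|Y|.
  move=> iK; have [sX _] := lX i iK; rewrite ltn_neqAle subset_leq_card // andbT.
  apply/eqP=> cX; have XY : X i = Y by apply/eqP; rewrite eqEcard sX cX /=.
  pose j := (i == 0).
  have jK : j < 160 * g by rewrite /j; case: (i == 0); lia.
  have ij : i != j by rewrite /j; case: (i) => [|[|?]].
  have [sXj _] := lX j jK; have /card_gt0P[x Xx] := X0 j jK.
  have := dX i j iK jK ij; rewrite -setI_eq0 => /eqP/setP/(_ x).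
  by rewrite !inE Xx XY (subsetP sXj) // -setI_eq0.
have {}IH i : i < 160 * g -> exists B, balanced phi (X i) B.
  by move=> iK; apply: IH; [apply: X0 | apply: X_small].
(* The indices are odd, as chains require. The left block ends at [78 g + 1], the right one runs
   from [80 g + 1] to [158 g + 1]: around each of its indices there is room for [g] slots, above [b]
   and below [160 g]. *)
pose c o u := 2 * g * (u + o) + 1.
have cK o (u : 'I_40) : o <= 40 -> c o u < 160 * g.
  move=> leo; rewrite /c; have ltu := ltn_ord u.
  have : 2 * g * (u + o) <= 2 * g * 79 by rewrite leq_mul2l; apply/orP; right; lia.
  by lia.
have odd_c o u : odd (c o u) by rewrite /c addn1 /= -mulnA mul2n odd_double.
have c_incr o u v : u < v -> c o u < c o v.
  by move=> uv; rewrite /c ltn_add2r ltn_pmul2l ?muln_gt0 ?g0 // ltn_add2r.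
(* More than half of some [X i] is a linear set, so tightness gives a dense [z] an out-neighbourhood
   with at least two thirds of [tr Y]. *)
pose dense z := ~~ [forall i : 'I_(160 * g), 2 * #|outN (X i) z| <= #|X i|].
have dense_large z : dense z -> 2 * tr Y <= 3 * tr (outN Y z).
  rewrite /dense negb_forall => /existsP[i]; rewrite -ltnNge => lt_i.
  have [sX leX] := lX i (ltn_ord i).
  have sN : outN (X i) z \subset Y.
    by apply: subset_trans sX; apply/subsetP=> w; rewrite inE => /andP[].
  have sNN : outN (X i) z \subset outN Y z.
    by apply/subsetP=> w; rewrite !inE => /andP[/(subsetP sX)-> ->].
  have ltN : 16 * h * tr Y < 16 * h * tr (outN (X i) z) + tr Y.
    apply: tY => //; apply: leq_trans leX (leq_trans (leq_mul (leqnn N0) (ltnW lt_i)) _).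
    have -> : N0 * (2 * #|outN (X i) z|) = 2 * (N0 * #|outN (X i) z|) by ring.
    have -> : 8 * h * N0 * #|outN (X i) z| = (8 * h) * (N0 * #|outN (X i) z|) by ring.
    by rewrite leq_mul2r; move: h_gt0; lia.
  have leN := trS sNN; rewrite leqNgt; apply/negP=> lt3.
  have := leq_mul (leqnn h) lt3; have := leq_mul (leqnn h) leN.
  have := leq_mul h_gt0 (leqnn (tr Y)); have := leq_mul (leqnn h) (leqnn 1).
  by move: h_gt0 ltN; lia.
have chain o z : o <= 40 -> good Y z -> ~~ dense z ->
    \sum_(u < 40) tr (outN (X (c o u)) z) <= tr (outN Y z).
  move=> leo gz; rewrite negbK => /forallP nd.
  apply: (@tr_outN_chain T (160 * g) L N0 h Y X h_gt0 leL smX tY 40 (c o) (160 * g)) => //.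
  - by move=> u ltu; rewrite odd_c (cK o (Ordinal ltu)).
  - by move=> u v /andP[uv _]; apply: c_incr.
  - by move=> i /lX[].
  - by move=> i ltiK; apply: nd (Ordinal ltiK).
pose b := 79 * g + 1.
have bK : b <= 160 * g by rewrite /b; lia.
have right_good (v : 'I_40) (z : T) : z \in X (c 40 v) ->
    (forall u : 'I_40, good (X (c 0 u)) z) /\
    \sum_(u < 40) tr (outN (X (c 0 u)) z) <= tr Y.
  move=> Xz; have ltk : c 40 v < 160 * g by apply: cK.
  have bk : b + g <= c 40 v.
    rewrite /b /c; have : 2 * g * 40 <= 2 * g * (v + 40) by rewrite leq_mul2l leq_addl orbT.
    by lia.
  have kK : c 40 v + g <= 160 * g.
    rewrite /c; have := ltn_ord v => ltv.
    have : 2 * g * (v + 40) <= 2 * g * 79 by rewrite leq_mul2l; apply/orP; right; lia.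
    by lia.
  have gz := alpha_good plan leL smX tY Y_big nQ Xz bk kK.
  have cb (u : 'I_40) : c 0 u < b.
    rewrite /c /b; have ltu := ltn_ord u.
    have : 2 * g * (u + 0) <= 2 * g * 39 by rewrite leq_mul2l; apply/orP; right; lia.
    by lia.
  have XU i : i < b -> X i \subset \bigcup_(i < b) X i.
    by move=> ib; apply: (bigcup_sup (Ordinal ib)).
  split; first by move=> u; apply: goodS gz; apply: XU.
  apply: leq_trans (_ : tr (outN (\bigcup_(i < b) X i) z) <= _).
    apply: (@tr_outN_chain T (160 * g) L N0 h Y X h_gt0 leL smX tY 40 (c 0) b) => //.
    - by move=> u ltu; rewrite odd_c (cb (Ordinal ltu)).
    - by move=> u w /andP[uw _]; apply: c_incr.
    (* Arcs from [z] to the left are backward, so smoothness already bounds them by [1/32] of each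
       set. *)
    - move=> i ib; have ik : i < c 40 v by apply: leq_trans ib (leq_trans (leq_addr g b) bk).
      have := smooth_bad32 h_gt0 leL smX ltk (ltn_trans ik ltk) (negbT (gtn_eqF ik)) Xz.
      rewrite /bad /wrong ltnNge (ltnW ik) /= -/(outN (X i) z) => le32.
      by apply: leq_trans le32; rewrite leq_mul2r orbT.
  apply: trS; apply/subsetP=> w; rewrite inE => /andP[/bigcupP[i _ Xw] _].
  by have [sX _] := lX i (leq_trans (ltn_ord i) bK); apply: subsetP sX _ Xw.
have bal o : o <= 40 -> exists B : 'I_40 -> R,
    forall u : 'I_40, balanced phi (X (c o u)) (B u).
  move=> leo; have /fin_all_exists[B BP] : forall u : 'I_40, exists B, balanced phi (X (c o u)) B.
    by move=> u; apply: IH; apply: cK.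
  by exists B.
have [Bl ball] := bal 0 isT; have [Br balr] := bal 40 isT.
pose E : R := (15 / 16 * (phi #|Y| / (tr Y)%:R))%R.
have E0 : (0 <= E)%R by rewrite /E mulr_ge0 ?divr_ge0 //; lra.
have leE : (phi #|Y| / (tr Y)%:R <= 16 / 15 * E)%R by rewrite /E; lra.
have XE i : i < 160 * g -> (E <= phi #|X i| / (tr (X i))%:R)%R.
  move=> iK; have [sX leX] := lX i iK.
  have tX : (0 < (tr (X i))%:R :> R)%R by rewrite ltr0n tr_gt0 X0.
  apply: (@le_trans _ _ (phi #|X i| / (tr Y)%:R)%R); last first.
    by rewrite ler_wpM2l // lef_pV2 ?posrE // ler_nat trS.
  rewrite /E mulrA ler_wpM2r ?invr_ge0 //.
  have le1 : (phi #|Y| <= kappa * phi #|X i|)%R.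
    apply: phi_ratio; apply: leq_trans leX _.
    by rewrite leq_mul2r; apply/orP; right; rewrite leq_pmull // muln_gt0 h_gt0.
  have le2 : (kappa * phi #|X i| <= 16 / 15 * phi #|X i|)%R by rewrite ler_wpM2r.
  by have := le_trans le1 le2; lra.
have sXY o (u : 'I_40) : o <= 40 -> X (c o u) \subset Y.
  by move=> leo; have [] := lX _ (cK o u leo).
have [le1|/ltW gt1] := lerP (\sum_u Bl u)%R (10 * (tr Y)%:R)%R.
  apply: (@balanced_mix R T phi Y E dense Y0 E0 leE dense_large
            (fun u => X (c 0 u)) Bl) => //.
  - by move=> u; apply: sXY.
  - by move=> u; apply: XE; apply: cK.
  - by move=> z; apply: chain.
have [le2|/ltW gt2] := lerP (\sum_u Br u)%R (10 * (tr Y)%:R)%R.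
  apply: (@balanced_mix R T phi Y E dense Y0 E0 leE dense_large
            (fun u => X (c 40 u)) Br) => //.
  - by move=> u; apply: sXY.
  - by move=> u; apply: XE; apply: cK.
  - by move=> z; apply: chain.
exists (2 / 3 * (tr Y)%:R)%R.
apply: (@balanced_merge R T phi Y E dense Y0 E0 leE dense_large
          (fun u => X (c 0 u)) (fun u => X (c 40 u)) Bl Br) => //.
- by move=> u; apply: sXY.
- by move=> u; apply: sXY.
- by move=> u; apply: XE; apply: cK.
- by move=> u; apply: XE; apply: cK.
- by move=> z; apply: chain.
- by move=> z; apply: chain.
Qed.

Lemma all_balanced (Y : {set T}) : 0 < #|Y| -> exists B, balanced phi Y B.
Proof.
have [n] := ubnP #|Y|; elim: n Y => // n IHn Y; rewrite ltnS => leYn Y0.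
have [leY|/ltnW geY] := leqP #|Y| n0.
  exists 1%R; apply: balanced_base => //.
  have [le1|gt1] := leqP #|Y| 1.
    have -> : #|Y| = 1 by apply/eqP; rewrite eqn_leq le1.
    by apply: le_trans phi1 _; rewrite ler1n tr_gt0.
  apply: le_trans (phi_small leY) _; rewrite ler_nat.
  by apply: tr_log; rewrite expn1.
case: (boolP [exists Z : {set T}, [&& Z \subset Y, #|Y| <= 8 * h * N0 * #|Z| &
                16 * h * tr Z + tr Y <= 16 * h * tr Y]]).
  case/existsP=> Z /and3P[sZY leYZ trZ].
  have Z0 : 0 < #|Z| by have := leq_trans Y0 leYZ; rewrite muln_gt0 => /andP[].
  have ltZ : #|Z| < #|Y|.
    rewrite ltn_neqAle subset_leq_card // andbT; apply/eqP=> cZ.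
    have ZY : Z = Y by apply/eqP; rewrite eqEcard sZY cZ /=.
    by move: trZ Y0; rewrite ZY -tr_gt0; lia.
  have [B balZ] := IHn Z (leq_trans ltZ leYn) Z0.
  by exists B; apply: balanced_loose balZ.
rewrite negb_exists => /forallP noZ; apply: balanced_tight => //.
  move=> Z sZY leYZ; have := noZ Z; rewrite sZY leYZ /=.
  by rewrite -ltnNge.
by move=> Z Z0 ltZ; apply: IHn => //; apply: leq_trans ltZ leYn.
Qed.

End AllBalanced.

(** The exponent is fixed by [N ^ eta = kappa], where [N] bounds all size ratios and the sizes of
    the base case; the cube in [balanced_large] turns [eta] into [eta / 3]. *)
Lemma alpha_plan_erdos_hajnal (R : realType) (Q : tournament) (D : {set Q})
    (slot run pos : Q -> nat) (ctr : Q -> Q) (h g : nat) (h1 h2 h3 h4 h6 : Q) :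
  alpha_plan D slot run pos ctr h g h1 h2 h3 h4 h6 -> erdos_hajnal R Q.
Proof.
move=> plan; have h_gt0 := plan_h_gt0 (alpha_star plan) (alpha_D0 plan).
have [|N0 [n0 [N00 structure]]] := @smooth_structure Q (160 * g) (32 * h ^ 2).
  by rewrite muln_gt0 expn_gt0 h_gt0.
(* Sets with [2 ^ (16 * h)] vertices have [tr] above [16 * h], which absorbs the roundings in the
   star embedding. *)
pose n1 := maxn n0 (2 ^ (16 * h)).
pose N := maxn 2 (maxn n1 (8 * h * N0)).
have N2 : 2 <= N by rewrite leq_maxl.
(* Chosen so that [kappa * (16 h - 1) < 16 h]; it is at most [17/16], hence below [16/15]. *)
pose kappa : R := (1 + (16 * h)%:R^-1)%R.
have h16 : (16 <= (16 * h)%:R :> R)%R by rewrite (ler_nat _ 16) leq_pmulr.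
have hi : (0 < (16 * h)%:R^-1 :> R)%R by rewrite invr_gt0; lra.
have hi16 : ((16 * h)%:R^-1 <= 1 / 16 :> R)%R.
  by rewrite div1r lef_pV2 ?posrE //; lra.
have hh : ((16 * h)%:R^-1 * (16 * h)%:R = 1 :> R)%R by rewrite mulVf //; lra.
have lnN : (0 < ln (N%:R : R))%R by rewrite ln_gt0 // ltr1n.
pose eta : R := (ln kappa / ln N%:R)%R.
have kappa1 : (1 < kappa)%R by rewrite /kappa; lra.
have eta0 : (0 < eta)%R by rewrite divr_gt0 // ln_gt0.
have NR : (0 < N%:R :> R)%R by rewrite ltr0n (leq_trans _ N2).
have powN : (N%:R `^ eta = kappa)%R.
  rewrite /powR gt_eqF // /eta divfK ?gt_eqF // lnK // posrE; lra.
pose phi (n : nat) : R := (n%:R `^ eta)%R.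
have phi_le m n : m <= n -> (phi m <= phi n)%R.
  by move=> lemn; rewrite ge0_ler_powR ?nnegrE ?ler0n ?ler_nat ?ltW.
have bal (T : tournament) (nQ : ~ contains T Q) (Y : {set T}) :
    0 < #|Y| -> exists B, balanced phi Y B.
  apply: (@all_balanced Q D slot run pos ctr h g h1 h2 h3 h4 h6 plan R T phi kappa
            (32 * h ^ 2) N0 n1 (leqnn _) nQ).
  - by move=> Z Z0 leZ; apply: structure => //; apply: leq_trans leZ; apply: leq_maxl.
  - exact: leq_maxr.
  - by move=> n; apply: powR_ge0.
  - by rewrite /phi powR1.
  - move=> n len; apply: le_trans (_ : phi N <= _)%R.
      by apply: phi_le; apply: leq_trans len _; apply: leq_trans (leq_maxl n1 _) (leq_maxr 2 _).
    by rewrite /phi powN /kappa; lra.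
  - move=> n m len; rewrite -powN -powRM ?ler0n // -natrM.
    apply: phi_le; apply: leq_trans len _; rewrite leq_mul2r; apply/orP; right.
    exact: leq_trans (leq_maxr n1 _) (leq_maxr 2 _).
  - by rewrite /kappa; lra.
  - rewrite /kappa mulrDl mul1r mulrBr hh; lra.
exists (eta / 3)%R; split; first by rewrite divr_gt0.
move=> T nQ.
have [T0|T0] := posnP #|T|.
  exists set0; split; first exact/trans_set_transitive/trans_set0.
  by rewrite T0 powR0 ?cards0 // gt_eqF // divr_gt0.
have [|B] := bal T nQ setT; first by rewrite cardsT.
move=> /balanced_large; rewrite cardsT => le3.
have [S [_ trS_ cS]] := tr_witness [set: T].
exists S; split; first exact: trans_set_transitive.
rewrite cS leNgt; apply/negP=> lt3; move: le3; rewrite leNgt => /negP; apply.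
have -> : phi #|T| = ((#|T|%:R `^ (eta / 3)) ^+ 3)%R.
  by rewrite -powR_mulrn ?powR_ge0 // -powRrM divfK // pnatr_eq0.
by rewrite natrX ltrXn2r.
Qed.

(** * Stars of a galaxy *)

Section GalaxyStars.
Variables (G : tournament) (s : seq G) (Z : {set G}).
Hypothesis gal : galaxy_ordering s Z.

Lemma galaxy_mem x : x \in s.
Proof. by have /perm_mem-> := gal.1; rewrite mem_enum. Qed.

Lemma bgraphC x y : bgraph s x y = bgraph s y x.
Proof. by rewrite /bgraph orbC. Qed.

Lemma bgraph_neq x y : bgraph s x y -> x != y.
Proof. by apply: contraTneq => ->; rewrite /bgraph /backward tarc_irr. Qed.

Lemma star_component c y : bgraph s c y -> c \in Z ->
  exists C, [/\ star s C, c \in C, y \in C, C :&: Z = [set c] &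
    left_star s C c \/ right_star s C c].
Proof.
move=> cy Zc; pose C := [set u | connect (bgraph s) c u].
have Cc : c \in C by rewrite inE connect0.
have Cy : y \in C by rewrite inE connect1.
have compC : component s C by exists c.
have C1 : 1 < #|C|.
  have /subset_leq_card : [set c; y] \subset C by rewrite subUset !sub1set Cc Cy.
  by rewrite cards2 (bgraph_neq cy).
have [C1'|[c' [CZ st]]] := gal.2.1 C compC; first by rewrite C1' in C1.
have cc' : c = c' by have : c \in C :&: Z by [rewrite inE Cc]; rewrite CZ => /set1P.
by exists C; rewrite CZ -cc'; split=> //; rewrite cc'.
Qed.

Lemma bgraph_center x y : bgraph s x y -> (x \in Z) (+) (y \in Z).
Proof.
move=> xy; pose C := [set u | connect (bgraph s) x u].
have Cx : x \in C by rewrite inE connect0.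
have Cy : y \in C by rewrite inE connect1.
have compC : component s C by exists x.
have [/eqP/cards1P[w CE]|[c [CZ st]]] := gal.2.1 C compC.
  by move: Cx Cy (bgraph_neq xy); rewrite CE => /set1P-> /set1P->; rewrite eqxx.
have [_ _ /(_ x y Cx Cy)] : star_at s C c by case: st => [[]|[]].
rewrite xy => /esym.
have ZC w : w \in C -> (w \in Z) = (w == c).
  by move=> Cw; have /setP/(_ w) := CZ; rewrite in_setI Cw in_set1.
by rewrite !ZC // => ->.
Qed.

Lemma center_unique x c c' : c \in Z -> c' \in Z -> bgraph s x c -> bgraph s x c' ->
  c = c'.
Proof.
move=> Zc Zc' xc xc'; pose C := [set u | connect (bgraph s) x u].
have compC : component s C by exists x.
have Cx : x \in C by rewrite inE connect0.
have Cc : c \in C by rewrite inE connect1.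
have Cc' : c' \in C by rewrite inE connect1.
have [/eqP/cards1P[w CE]|[c0 [CZ _]]] := gal.2.1 C compC.
  by move: Cc Cc'; rewrite CE => /set1P-> /set1P->.
have in0 w : w \in C -> w \in Z -> w = c0.
  by move=> Cw Zw; apply/set1P; rewrite -CZ in_setI Cw.
by rewrite (in0 c) // (in0 c').
Qed.

(** For the center of another star this is the galaxy condition; the center of the same star comes
    before or after all its leaves. *)
Lemma leaves_no_center c c0 x y w : c \in Z -> x \notin Z -> y \notin Z ->
  bgraph s c x -> bgraph s c y -> c0 \in Z -> bgraph s c0 w ->
  ~~ (before s x c0 && before s c0 y).
Proof.
move=> Zc nZx nZy cx cy Zc0 c0w.
have [C [stC Cc Cx CZ sideC]] := star_component cx Zc.
have Cy : y \in C.
  have [C' [_ C'c C'y C'Z _]] := star_component cy Zc.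
  have [[c1 CE] _] := stC; move: Cc; rewrite CE !inE => c1c.
  by apply: connect_trans c1c (connect1 cy).
case: (eqVneq c c0) => [<-|cc0].
  have xc : x \in C :\ c by rewrite !inE Cx andbT; apply: contraNneq nZx => ->.
  have yc : y \in C :\ c by rewrite !inE Cy andbT; apply: contraNneq nZy => ->.
  case: sideC => [[_ side]|[_ side]].
    by have := side x xc; rewrite /before => /ltnW; rewrite leqNgt => /negbTE->.
  by have := side y yc; rewrite /before andbC => /ltnW; rewrite leqNgt => /negbTE->.
have [C0 [stC0 Cc0 _ C0Z _]] := star_component c0w Zc0.
have CC0 : C0 != C.
  apply: contraNneq cc0 => e; move: C0Z; rewrite e CZ => /setP/(_ c).
  by rewrite !inE eqxx => /esym/eqP->.
apply: (gal.2.2 C0 C stC0 stC CC0); first by rewrite C0Z set11.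
  by rewrite !inE nZx.
by rewrite !inE nZy.
Qed.

Lemma leaves_no_split k c x y : no_split_star s Z k -> c \in Z -> x \notin Z ->
  y \notin Z -> bgraph s c x -> bgraph s c y ->
  ~~ ((index x s < k) && (k <= index y s)).
Proof.
move=> nsp Zc nZx nZy cx cy.
have [C [stC Cc Cx CZ sideC]] := star_component cx Zc.
have Cy : y \in C.
  have [[c1 CE] _] := stC; move: Cc; rewrite CE !inE => c1c.
  by apply: connect_trans c1c (connect1 cy).
by apply: nsp stC _ _ _ _; rewrite !inE ?nZx ?nZy.
Qed.

End GalaxyStars.

(** * The embedding plan of an alpha-galaxy *)

Section AlphaGalaxyPlan.
Variables (G : tournament) (s : seq G) (Z : {set G}) (s_gal : galaxy_ordering s Z).
Variables r1 r2 r3 : nat.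
Hypothesis cardG : #|G| = r1 + r2 + r3.
Hypothesis nsp : no_split_star s Z r1.

Let P := product (rho_inj (r1 := r1) (r2 := r2) (proj1 s_gal)).
Let lab : P -> nat := sum_label (rho1 r1 r2) (rho2 s r1 r2).
Let sb : rel P := @sum_backward Hs G (rho1 r1 r2) (rho2 s r1 r2).

Definition hv (i : nat) : 'I_7 := inord i.
(* hs i is the vertex h_(i+1) of H_s. *)
Let hs (i : nat) : P := inl (hv i).

Lemma lab_inj : injective lab.
Proof. exact: rho_inj (proj1 s_gal). Qed.

Lemma sb_lab u v : sb u v -> lab v < lab u.
Proof. by case: u v => [x|x] [y|y] //= /andP[]. Qed.

Lemma productE u v : tarc u v = (u != v) && (if lab u < lab v then ~~ sb v u else sb u v) :> bool.
Proof. by []. Qed.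

Lemma rho1_mono (x y : 'I_7) : (rho1 r1 r2 x < rho1 r1 r2 y) = (x < y).
Proof.
have := ltn_ord x; have := ltn_ord y; rewrite /rho1.
by do !case: ifP; lia.
Qed.

Lemma rho2_mono x y : (rho2 s r1 r2 x < rho2 s r1 r2 y) = (index x s < index y s).
Proof. by rewrite /rho2; do !case: ifP; lia. Qed.

Lemma sb_inr x y : sb (inr x) (inr y) = backward s x y.
Proof. by rewrite /sb /= rho2_mono. Qed.

Lemma tarc_inl (x y : 'I_7) :
  @tarc P (inl x) (inl y) = (@tarc Hs x y).
Proof.
rewrite productE /lab /sb /sum_label /sum_backward !rho1_mono (_ : (inl x != inl y :> P) = (x != y)) //.
have [->|xy] := eqVneq x y; first by rewrite tarc_irr.
have yx : y != x by rewrite eq_sym.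
case: ltngtP => [lt|lt|e]; rewrite ?andbT ?andbF //.
  by rewrite andTb (@arcC Hs _ _ yx).
by move: xy; rewrite -val_eqE /= e eqxx.
Qed.

Lemma Hs_arc i j : i < 7 -> j < 7 ->
  @tarc Hs (hv i) (hv j) = (i != j) &&
    (if i < j then (j.+1, i.+1) \notin [:: (4, 1); (6, 4); (6, 3); (7, 5)]
     else (i.+1, j.+1) \in [:: (4, 1); (6, 4); (6, 3); (7, 5)]).
Proof.
move=> i7 j7; rewrite /= /arc_of_backward /Hs_backward -val_eqE /=.
by rewrite !inordK.
Qed.

Lemma hvE (i : 'I_7) k : k < 7 -> (i == hv k) = (i == k :> nat).
Proof. by move=> k7; rewrite -val_eqE /= inordK. Qed.

(** [hv 4] is [h5], chosen as center of the star on [h5], [h7] because it precedes all of [G],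
    whereas [h7] could separate leaves of a star of [G]; [hv 5] is [h6]. In [G] a neighbour is
    demanded because [Z] may contain isolated vertices, and these could separate leaves too. *)
Definition is_center (u : P) : bool :=
  match u with
  | inl i => (i == hv 4) || (i == hv 5)
  | inr v => (v \in Z) && [exists y, bgraph s v y]
  end.

(** The default makes an isolated vertex its own center. *)
Definition galaxy_ctr (v : G) : G :=
  if v \in Z then v else odflt v [pick c | (c \in Z) && bgraph s v c].

Definition ctr_of (u : P) : P :=
  match u with
  | inl i => if i == hv 6 then hs 4 else inl i
  | inr v => inr (galaxy_ctr v)
  end.

Definition plan_dom : {set P} :=
  [set u | u \notin [:: hs 0; hs 1; hs 2; hs 3; hs 5]].

Lemma dom_inl (i : 'I_7) : (inl i : P) \in plan_dom -> i = hv 4 \/ i = hv 6.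
Proof.
have inl_eq k : (inl i == hs k :> P) = (i == hv k) by [].
rewrite !inE !inl_eq !hvE // => ni.
suff : (i == hv 4) || (i == hv 6) by case/orP=> /eqP; [left | right].
by rewrite !hvE //; move: (ltn_ord i) ni; case: (nat_of_ord i) => [|[|[|[|[|[|[|?]]]]]]].
Qed.

Lemma sb64 : sb (hs 6) (hs 4).
Proof. by rewrite /sb /hs /sum_backward rho1_mono Hs_arc //= !inordK. Qed.

Lemma hv_neq i j : i < 7 -> j < 7 -> i != j -> (hv i == hv j) = false.
Proof. by move=> i7 j7 ij; rewrite hvE // inordK // (negbTE ij). Qed.

Lemma galaxy_ctr_leaf c x : c \in Z -> x \notin Z -> bgraph s c x -> galaxy_ctr x = c.
Proof.
move=> Zc nZx cx; rewrite /galaxy_ctr (negbTE nZx); case: pickP => [c' /andP[Zc' xc']|no] /=.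
  by apply: (center_unique s_gal Zc' Zc xc'); rewrite bgraphC.
by have := no c; rewrite Zc bgraphC cx.
Qed.

Lemma galaxy_ctrP x : galaxy_ctr x != x ->
  [/\ galaxy_ctr x \in Z, x \notin Z & bgraph s (galaxy_ctr x) x].
Proof.
rewrite /galaxy_ctr; case: ifP => [|nZ]; first by rewrite eqxx.
by case: pickP => [c /andP[Zc xc]|] /=; rewrite ?eqxx // Zc bgraphC.
Qed.

Lemma edge_center u v : u \in plan_dom -> v \in plan_dom -> sb u v ->
  [/\ is_center u, ~~ is_center v, ctr_of u = u & ctr_of v = u] \/
  [/\ is_center v, ~~ is_center u, ctr_of v = v & ctr_of u = v].
Proof.
case: u v => [i|x] [j|y] //.
  move=> /dom_inl ui /dom_inl uj.
  have e64 : hv 6 == hv 4 = false by rewrite hv_neq.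
  have e65 : hv 6 == hv 5 = false by rewrite hv_neq.
  have e46 : hv 4 == hv 6 = false by rewrite hv_neq.
  case: ui uj => -> [] -> sij.
  - by have := sb_lab sij; rewrite ltnn.
  - by left; rewrite /= eqxx e64 e65 e46 /hs !eqxx.
  - by right; rewrite /= eqxx e64 e65 e46 /hs !eqxx.
  - by have := sb_lab sij; rewrite ltnn.
move=> _ _; rewrite sb_inr => bxy.
have xy : bgraph s x y by rewrite /bgraph bxy.
have yx : bgraph s y x by rewrite bgraphC.
have := bgraph_center s_gal xy; rewrite /is_center /ctr_of.
case Zx: (x \in Z); case Zy: (y \in Z) => //= _.
  left; rewrite (galaxy_ctr_leaf Zx (negbT Zy) xy) {1}/galaxy_ctr Zx; split=> //.
  by apply/existsP; exists y.
right; rewrite (galaxy_ctr_leaf Zy (negbT Zx) yx) {1}/galaxy_ctr Zy; split=> //.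
by apply/existsP; exists x.
Qed.

Lemma leaf_ctr v : v \in plan_dom -> ctr_of v != v ->
  [/\ ctr_of v \in plan_dom, ctr_of (ctr_of v) = ctr_of v, is_center (ctr_of v),
      ~~ is_center v & sb v (ctr_of v) || sb (ctr_of v) v].
Proof.
case: v => [i|x].
  case/dom_inl=> ->; rewrite /ctr_of; first by rewrite hv_neq // => /eqP.
  rewrite eqxx => _; rewrite sb64; split=> //.
  - have inl_eq k : (hs 4 == hs k) = (hv 4 == hv k) by [].
    by rewrite !inE !inl_eq !hvE // !inordK.
  - by rewrite /hs hv_neq.
  - by rewrite /is_center /hs eqxx.
  - by rewrite /is_center !hv_neq.
move=> _; rewrite /ctr_of => cx.
have [Zc nZx bcx] : [/\ galaxy_ctr x \in Z, x \notin Z & bgraph s (galaxy_ctr x) x].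
  by apply: galaxy_ctrP; apply: contraNneq cx => ->.
split.
- by rewrite !inE.
- by congr inr; rewrite {1}/galaxy_ctr Zc.
- by rewrite /is_center Zc; apply/existsP; exists x.
- by rewrite /is_center (negbTE nZx).
- by rewrite !sb_inr -/(bgraph s x (galaxy_ctr x)) bgraphC.
Qed.

Lemma lab_hs4 : lab (hs 4) = 5.
Proof. by rewrite /lab /= /rho1 /hv inordK. Qed.

Lemma lab_hs5 : lab (hs 5) = 6 + r1.
Proof. by rewrite /lab /= /rho1 /hv inordK. Qed.

Lemma lab_inr5 x : 5 < lab (inr x).
Proof. by rewrite /lab /= /rho2; do !case: ifP; lia. Qed.

Lemma lab_inr_lt x : (lab (inr x) < 6 + r1) = (index x s < r1).
Proof. by rewrite /lab /= /rho2; do !case: ifP; lia. Qed.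

Lemma lab_lt_inr x : (6 + r1 < lab (inr x)) = (r1 <= index x s).
Proof. by rewrite /lab /= /rho2; do !case: ifP; lia. Qed.

(* h6 counts as a center: it separates the leaves before it from those after it. *)
Definition centers_before (u : P) := #|[set c | is_center c & lab c < lab u]|.
(** Each center has an odd slot to itself; the other vertices between two consecutive centers share
    an even one. *)
Definition slot_of (u : P) := 2 * centers_before u + is_center u.

Lemma slot_le u v : lab u < lab v -> slot_of u <= slot_of v ?= iff
  ~~ (is_center u || is_center v) && (centers_before u == centers_before v).
Proof.
move=> uv.
have sub : [set c | is_center c & lab c < lab u] \subset
    [set c | is_center c & lab c < lab v].
  by apply/subsetP=> c; rewrite !inE => /andP[-> /ltn_trans->].
have le := subset_leq_card sub; rewrite -/(centers_before u) -/(centers_before v) in le.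
have lt : is_center u -> centers_before u < centers_before v.
  move=> cu; apply/proper_card/properP; split=> //.
  by exists u; rewrite !inE cu ?uv // ltnn.
rewrite /slot_of; case cu: (is_center u) lt => lt; case cv: (is_center v) => /=;
  apply/leqifP; rewrite ?addn0 ?addn1.
- by have := lt isT; lia.
- by have := lt isT; lia.
- by lia.
- by case: eqVneq => [->//|ne]; lia.
Qed.

Lemma slot_lt_lab u v : slot_of u < slot_of v -> lab u < lab v.
Proof.
move=> lt; rewrite ltnNge leq_eqVlt; apply/negP=> /orP[/eqP/lab_inj e|/slot_le[le _]].
  by rewrite e ltnn in lt.
by rewrite leqNgt lt in le.
Qed.

Lemma lab_slot_lt u v : is_center u || is_center v ->
  (slot_of u < slot_of v) = (lab u < lab v).
Proof.
move=> cuv; apply/idP/idP; first exact: slot_lt_lab.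
by move/slot_le=> [le e]; rewrite ltn_neqAle le andbT e cuv.
Qed.

Lemma slot_eq_center u v : slot_of u = slot_of v -> is_center v -> u = v.
Proof.
move=> e cv; apply: lab_inj; apply/eqP.
rewrite eqn_leq leqNgt [X in _ && X]leqNgt.
have c1 : is_center u || is_center v by rewrite cv orbT.
have c2 : is_center v || is_center u by rewrite cv.
by rewrite -(lab_slot_lt c1) -(lab_slot_lt c2) e ltnn.
Qed.

(** A center of [G] cannot separate leaves by the galaxy condition, [h5] precedes [G], and [h6]
    stands at the cut [r1], which splits the leaves of no star. The star of [h5] has [h7] as its
    only leaf. *)
Lemma center_before_leaves x y c0 : x \in plan_dom -> y \in plan_dom ->
  ctr_of x = ctr_of y -> ctr_of x != x -> ctr_of y != y -> is_center c0 ->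
  lab c0 < lab y -> lab c0 < lab x.
Proof.
move=> Dx Dy cxy cx cy cc0 lt_y.
have [_ _ _ nCx _] := leaf_ctr Dx cx.
rewrite ltnNge leq_eqVlt; apply/negP=> /orP[/eqP/lab_inj e|lt_x].
  by rewrite e cc0 in nCx.
case: x y Dx Dy cxy cx cy lt_y nCx lt_x => [i|x] [j|y] Dx Dy cxy cx cy lt_y nCx lt_x.
- move: cx cy lt_y lt_x; case: (dom_inl Dx) => ->; case: (dom_inl Dy) => ->.
  + by rewrite /ctr_of hv_neq // => /eqP.
  + by rewrite /ctr_of hv_neq // => /eqP.
  + by rewrite /ctr_of eqxx hv_neq // => _ /eqP.
  + by move=> _ _ lt_y /(ltn_trans lt_y); rewrite ltnn.
- by move: cxy; rewrite /ctr_of; case: ifP.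
- by move: cxy; rewrite /ctr_of; case: ifP.
case: cxy => cxy.
have [Zc nZx bcx] : [/\ galaxy_ctr x \in Z, x \notin Z & bgraph s (galaxy_ctr x) x].
  by apply: galaxy_ctrP; apply: contraNneq cx => e; rewrite /ctr_of e.
have [_ nZy bcy] : [/\ galaxy_ctr y \in Z, y \notin Z & bgraph s (galaxy_ctr y) y].
  by apply: galaxy_ctrP; apply: contraNneq cy => e; rewrite /ctr_of e.
rewrite -cxy in bcy.
case: c0 cc0 lt_y lt_x => [i|c0] cc0 lt_y lt_x; last first.
  move: cc0 lt_y lt_x; rewrite /lab /= => /andP[Zc0 /existsP[w c0w]]; rewrite !rho2_mono => lt_y lt_x.
  have := leaves_no_center s_gal Zc nZx nZy bcx bcy Zc0 c0w.
  by rewrite /before lt_x lt_y.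
have := leaves_no_split s_gal nsp Zc nZx nZy bcx bcy.
case/orP: cc0 lt_y lt_x => /eqP->.
  by rewrite lab_hs4 => _ /(ltn_trans (lab_inr5 x)); rewrite ltnn.
by rewrite lab_hs5 lab_inr_lt lab_lt_inr => -> ->.
Qed.

Lemma slot_leaves x y : x \in plan_dom -> y \in plan_dom ->
  ctr_of x = ctr_of y -> ctr_of x != x -> ctr_of y != y -> slot_of x = slot_of y.
Proof.
move=> Dx Dy cxy cx cy.
have [_ _ _ /negbTE nx _] := leaf_ctr Dx cx; have [_ _ _ /negbTE ny _] := leaf_ctr Dy cy.
rewrite /slot_of nx ny !addn0; congr (2 * _); apply: eq_card => c0; rewrite !inE.
case cc0: (is_center c0) => //=; apply/idP/idP; apply: center_before_leaves => //.
Qed.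

(** Any leaf of the star of [u] will do, since they all share a slot; a vertex in no star keeps its
    own slot. *)
Definition run_of (u : P) :=
  if [pick x in plan_dom | (ctr_of x == ctr_of u) && (x != ctr_of u)] is Some x
  then slot_of x else slot_of u.

Lemma lab_bound u : lab u < 8 + #|G|.
Proof.
case: u => [i|x]; rewrite /lab /= cardG.
  by rewrite /rho1; have := ltn_ord i; do !case: ifP; lia.
have : index x s < size s by rewrite index_mem (galaxy_mem s_gal).
have -> : size s = #|G| by have /perm_size-> := s_gal.1; rewrite -cardE.
by rewrite cardG /rho2; do !case: ifP; lia.
Qed.

Lemma ctr_of_dom v : v \in plan_dom ->
  ctr_of v \in plan_dom /\ ctr_of (ctr_of v) = ctr_of v.
Proof.
move=> Dv; case: (eqVneq (ctr_of v) v) => [e|cv]; first by rewrite !e.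
by have [] := leaf_ctr Dv cv.
Qed.

(** [8 + #|G|] exceeds both the number [7 + #|G|] of vertices and every label. *)
Lemma product_star_plan :
  star_plan plan_dom slot_of run_of lab ctr_of (8 + #|G|).
Proof.
split.
- have -> : #|P| = 7 + #|G| by rewrite card_sum card_ord.
  by rewrite leq_add2r.
- exact: lab_bound.
- by move=> v /ctr_of_dom[].
- by move=> v /ctr_of_dom[].
- move=> v Dv; have [_ cc] := ctr_of_dom Dv; rewrite /run_of cc.
  case: pickP => // no; have := no v; rewrite Dv eqxx /= => /negbFE/eqP e.
  by rewrite -e.
- move=> v Dv cv; have [Dc cc Cc nCv ed] := leaf_ctr Dv cv.
  split.
  + rewrite /run_of; case: pickP => [x /and3P[Dx /eqP cx xc]|//].
    by apply: slot_leaves => //; rewrite cx // eq_sym.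
  + apply/eqP=> e; have := slot_eq_center (esym e) Cc => vc.
    by rewrite -vc eqxx in cv.
  + rewrite lab_slot_lt ?Cc // productE eq_sym cv /=.
    case/orP: ed => ed.
      by rewrite ltnNge (ltnW (sb_lab ed)) /= ed (sb_lab ed).
    rewrite (sb_lab ed) ed /=; apply/esym/negbTE.
    by rewrite -leqNgt ltnW // sb_lab.
- move=> v Dv; rewrite /run_of; case: pickP => [x /and3P[Dx /eqP cx xc]|]; last first.
    by rewrite eqxx.
  have cxx : ctr_of x != x by rewrite cx eq_sym.
  case: (eqVneq (ctr_of v) v) => [cv|cv]; last by rewrite (slot_leaves Dx Dv) // eqxx.
  have [_ _ Cc _ _] := leaf_ctr Dx cxx; rewrite cx cv in Cc xc => _.
  split; first by move=> u _ e; apply: slot_eq_center e Cc.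
  by exists x => //; rewrite cx cv.
(* Inside [plan_dom] a backward arc joins a center to one of its leaves, so arcs between different
   stars are forward. *)
- move=> u v Du Dv cuv lt; have ltl := slot_lt_lab lt.
  rewrite productE ltl; have -> /= : u != v by apply: contraNneq cuv => ->.
  apply: contraNN cuv => svu.
  by case: (edge_center Dv Du svu) => -[_ _ -> ->].
- move=> u v Du Dv suv uv; split.
    by apply: contra uv => /eqP/lab_inj->.
  move=> ltl; rewrite productE ltl uv /=; apply/negP=> svu.
  case: (edge_center Dv Du svu) => -[Cu _ _ _].
    by have := slot_eq_center suv Cu => e; rewrite e eqxx in uv.
  by have := slot_eq_center (esym suv) Cu => e; rewrite e eqxx in uv.
Qed.

Lemma dom_hs k : k < 7 -> (hs k \in plan_dom) = (k == 4) || (k == 6).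
Proof.
move=> k7; have inl_eq j : (hs k == hs j) = (hv k == hv j) by [].
rewrite !inE !inl_eq !hvE // !inordK //.
by move: k7; case: k {inl_eq} => [|[|[|[|[|[|[|?]]]]]]].
Qed.

Lemma arc_hs i j : i < 7 -> j < 7 ->
  tarc (hs i) (hs j) = (i != j) &&
    (if i < j then (j.+1, i.+1) \notin [:: (4, 1); (6, 4); (6, 3); (7, 5)]
     else (i.+1, j.+1) \in [:: (4, 1); (6, 4); (6, 3); (7, 5)]).
Proof. by move=> i7 j7; rewrite tarc_inl Hs_arc. Qed.

Lemma product_alpha_plan :
  alpha_plan plan_dom slot_of run_of lab ctr_of (8 + #|G|) (2 * #|P| + 2)
    (hs 0) (hs 1) (hs 2) (hs 3) (hs 5).
Proof.
split.
- exact: product_star_plan.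
- by apply/set0Pn; exists (hs 4); rewrite dom_hs.
- by move=> v; rewrite inE negbK.
- by move=> v hvv; rewrite inE negbK.
- by rewrite /five !arc_hs.
- move=> u v hu Dv.
  have [k k4 ->] : exists2 k, k < 4 & u = hs k.
    by move: hu; rewrite !inE => /or4P[] /eqP->; [exists 0 | exists 1 | exists 2 | exists 3].
  have k7 : k < 7 by apply: leq_trans k4 _.
  case: v Dv => [i|x] Dv.
    case: (dom_inl Dv) => ->; rewrite -/(hs _) arc_hs //;
    by move: k4; case: k {k7} => [|[|[|[|?]]]].
  rewrite productE /= ifT // /lab /= /rho1 /rho2 inordK //.
  by move: k4; do !case: ifP; lia.
- move=> v Dv; have C5 : is_center (hs 5) by rewrite /= eqxx orbT.
  have neq : v != hs 5 by apply: contraTneq Dv => ->; rewrite dom_hs.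
  split; first by apply: contra neq => /eqP e; rewrite (slot_eq_center e C5).
  rewrite lab_slot_lt ?C5 //; case: v Dv neq => [i|x] Dv neq.
    case: (dom_inl Dv) => ->; rewrite -/(hs _) arc_hs //;
    by rewrite /lab /sum_label rho1_mono !inordK.
  by rewrite productE eq_sym neq /=; case: ifP.
- move=> v; rewrite /slot_of; have : centers_before v <= #|P| by apply: max_card.
  by case: (is_center v) => /=; lia.
Qed.

End AlphaGalaxyPlan.

Theorem theorem20 (R : realType) (H : tournament) :
  alpha_galaxy H -> erdos_hajnal R H.
Proof.
case=> G [s [Z [s_gal [r1 [r2 [r3 [cardG nsp [phi [phi_bij phi_mono]]]]]]]]].
have [eps [eps0 epsP]] := alpha_plan_erdos_hajnal R (product_alpha_plan s_gal cardG nsp).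
exists eps; split=> // T nH; apply: epsP => -[f [f_inj f_mono]].
apply: nH; exists (f \o phi); split; first exact: inj_comp f_inj (bij_inj phi_bij).
by move=> x y /=; rewrite f_mono phi_mono.
Qed.
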